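(* Let $\alpha\ge -1/2$, $\nu\in\mathbb{R}$ and $\mu=-\nu$. Let $f:\mathbb{R}_+\to\mathbb{C}$ be such that $t^{\nu}f(t)\in L^1(0,1)$, and $$|f(M)|=o\big(M^{-\nu-1}\big)\quad\text{as }M\to\infty,$$ $$\int_M^\infty t^{\nu-\alpha-1/2}\,|df(t)|=o\big(M^{-\alpha-3/2}\big)\quad\text{as }M\to\infty.$$ Then a necessary and sufficient condition for $\mathcal{L}^{\alpha}_{\nu,\mu}f(r)$ to converge uniformly on $\mathbb{R}_+$ is that the integral $\int_0^\infty t^{\nu}f(t)\,dt$ converges, i.e. $\left|\int_0^\infty t^\nu f(t)\,dt\right|<\infty$.
   Context: $\mathbb{R}_+=[0,\infty)$. For $\alpha\ge-1/2$, $j_\alpha(z)=\Gamma(\alpha+1)(z/2)^{-\alpha}J_\alpha(z)$ is the normalized Bessel function, where $J_\alpha$ is the Bessel function of the first kind of order $\alpha$ (so $j_\alpha(0)=1$). Standing assumption: $f:\mathbb{R}_+\to\mathbb{C}$ is locally of bounded variation and locally integrable on $(0,\infty)$. Integrals against $|df(t)|$ are Stieltjes integrals with respect to the total variation of $f$. The integral $\int_0^\infty t^\nu f(t)\,dt$ is understood as $\lim_{N\to\infty}\int_0^N t^\nu f(t)\,dt$; ''$|\int_0^\infty t^\nu f(t)dt|<\infty$'' means that this limit exists and is finite. The transform is $\mathcal{L}^{\alpha}_{\nu,\mu}f(r)=r^\mu\int_0^\infty (rt)^\nu f(t)j_\alpha(rt)\,dt$, where $r^\mu(rt)^\nu$ is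 read as $r^{\mu+\nu}t^\nu$ (so when $\mu+\nu=0$ the prefactor is $1$ for all $r\ge 0$, including $r=0$). It converges uniformly on a set $E\subset\mathbb{R}_+$ if the partial integrals $r^{\mu}\int_0^N (rt)^\nu f(t)j_\alpha(rt)\,dt$ converge uniformly in $r\in E$ as $N\to\infty$, equivalently $r^{\mu}\int_M^N (rt)^\nu f(t)j_\alpha(rt)\,dt\to0$ uniformly in $r\in E$ as $N>M\to\infty$. *)

(* Defs.v *)
From HB Require Import structures.
From mathcomp Require Import all_boot all_order all_algebra.
From mathcomp Require Import all_classical all_reals all_analysis.
From mathcomp Require Export complex.

Set Implicit Arguments.
Unset Strict Implicit.
Unset Printing Implicit Defensive.

Import Order.TTheory GRing.Theory Num.Theory.
Import numFieldNormedType.Exports.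

Local Open Scope classical_set_scope.
Local Open Scope ring_scope.

(* The modulus of a complex number, as an element of R: the norm `|z| of the
   numDomainType R[i] lives in R[i]. *)
Notation cmod := ComplexField.Normc.normc.

(* Lets the Landau notation f =o_+oo g be used; in the library the filter +oo of
   a numFieldType has no canonical filter_on structure. *)
Canonical pinfty_nbhs_filter_on (R : numFieldType) :=
  FilterType (pinfty_nbhs R) (@proper_pinfty_nbhs R).

Section bessel.
Context {R : realType}.
Implicit Types alpha x z : R.

(* Euler's integral; meaningful for 0 < x. *)
Definition Gamma x : R :=
  \int[lebesgue_measure]_(t in `]0, +oo[) (t `^ (x - 1) * expR (- t)).

(* The usual power series, for 0 < z and alpha > -1; then all the arguments of
   Gamma are positive. *)
Definition besselJ alpha z : R :=
  limn (series (fun k : nat =>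
    (-1) ^+ k / (k`!%:R * Gamma (k%:R + alpha + 1))
      * (z / 2) `^ (2 * k%:R + alpha))).

(* The value at 0 is the continuous extension. *)
Definition bessel_j alpha z : R :=
  if z == 0 then 1
  else Gamma (alpha + 1) * (z / 2) `^ (- alpha) * besselJ alpha z.

End bessel.

Section complex_integration.
Context {R : realType}.
Implicit Types (D : set R) (f : R -> R[i]).

Definition cintegrable D f : Prop :=
  lebesgue_measure.-integrable D (fun t => (complex.Re (f t))%:E) /\
  lebesgue_measure.-integrable D (fun t => (complex.Im (f t))%:E).

Definition clocally_integrable D f : Prop :=
  locally_integrable D (fun t => complex.Re (f t)) /\
  locally_integrable D (fun t => complex.Im (f t)).

Definition cintegral D f : R[i] :=
  ((\int[lebesgue_measure]_(t in D) complex.Re (f t))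
    +i* (\int[lebesgue_measure]_(t in D) complex.Im (f t)))%C.

End complex_integration.

Section total_variation.
Context {R : realType}.
Implicit Types (a b : R) (s : seq R) (f : R -> R[i]).

(* Counterparts, for complex-valued functions, of the library's variation,
   variations, bounded_variation and total_variation. *)
Definition cvariation a b f s : R :=
  let F := f \o nth b (a :: s) in
  \sum_(0 <= n < size s) cmod (F n.+1 - F n).

Definition cvariations a b f : set R :=
  [set cvariation a b f s | s in itv_partition a b].

Definition cbounded_variation a b f : Prop := has_ubound (cvariations a b f).

Definition ctotal_variation a b f : \bar R :=
  ereal_sup [set x%:E | x in cvariations a b f].

Definition clocally_bounded_variation f : Prop :=
  forall a b, 0 < a -> a <= b -> cbounded_variation a b f.

End total_variation.

Section stieltjes.
Context {R : realType}.
Implicit Types (a b : R) (s : seq R) (g V : R -> R).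

(* The points of the partition are a :: s, and xi n is the tag of its n-th
   interval. *)
Definition stieltjes_sum g V a s (xi : nat -> R) : R :=
  let p := nth a (a :: s) in
  \sum_(0 <= n < size s) g (xi n) * (V (p n.+1) - V (p n)).

(* I is the Riemann-Stieltjes integral of g with respect to V over [a, b]. *)
Definition is_stieltjes g V a b (I : R) : Prop :=
  forall e : R, 0 < e -> exists2 d : R, 0 < d &
    forall s (xi : nat -> R), itv_partition a b s ->
      (forall n, (n < size s)%N ->
        let p := nth a (a :: s) in
        [/\ p n <= xi n, xi n <= p n.+1 & p n.+1 - p n < d]) ->
      `|stieltjes_sum g V a s xi - I| < e.

(* I is the (finite) integral of g(t) |df(t)| over [a, +oo[. *)
Definition is_variation_integral g (f : R -> R[i]) a (I : R) : Prop :=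
  exists2 J : R -> R,
    (forall b, a <= b ->
      is_stieltjes g (fun t => fine (ctotal_variation a t f)) a b (J b)) &
    J b @[b --> +oo] --> I.

End stieltjes.

Section transform.
Context {R : realType}.
Implicit Types (alpha nu mu r N : R) (f : R -> R[i]).

(* r `^ (mu + nu) * t `^ nu is the meaning given to r^mu (rt)^nu; note that
   0 `^ 0 = 1. *)
Definition transform_partial alpha nu mu f N r : R[i] :=
  (r `^ (mu + nu))%:C%C *
  cintegral `[0, N] (fun t => (t `^ nu)%:C%C * f t * (bessel_j alpha (r * t))%:C%C).

(* R[i]^o is R[i] with the uniform structure given by its norm. *)
Definition transform_converges_uniformly alpha nu mu f (E : set R) : Prop :=
  exists L : R -> R[i]^o,
    {uniform E,
      (transform_partial alpha nu mu f N : R -> R[i]^o) @[N --> +oo] --> L}.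

Definition improper_integral_converges (g : R -> R[i]) : Prop :=
  cvg ((cintegral `[0, N] g : R[i]^o) @[N --> +oo]).

End transform.

(* Main.v *)
(* Necessity is convergence at [r = 0], where the kernel is 1.

   For sufficiency one shows that the integrals of [t^nu f(t) j(rt)] over [M, N]
   are small uniformly in [r], splitting at [1/r].  Below [1/r], [j(rt) - 1] is
   [O(rt)], and [f(t) = o(t^(-nu-1))] makes the error [r * (1/r) * o(1)], while the
   main term is a tail of the convergent integral.  Above [1/r], Bessel's equation
   gives
     [t^nu j(rt) = - (1/r) (t^nu j'(rt))' + (nu - 2 alpha - 1)/r t^(nu-1) j'(rt)].
   Since [j'(z) = O(z^(-alpha-1/2))], integrating the first term by parts against
   [df] leaves [r^(-alpha-3/2)] times quantities that are [o(M^(-alpha-3/2))] for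
   [M >= 1/r]; the second term is absolutely integrable with the same bound.

   The only facts about [j] needed are its differential equation, its behaviour at
   0 and the decay of [j'], all read off the power series; the recurrence between
   its coefficients is the functional equation of Gamma. *)
Require Import Defs.
From mathcomp Require Import all_boot all_order all_algebra.
From mathcomp Require Import all_classical all_reals all_analysis.
From mathcomp Require Import measurable_realfun ring lra.

Import Order.TTheory GRing.Theory Num.Theory.
Import numFieldNormedType.Exports.

Local Open Scope classical_set_scope.
Local Open Scope ring_scope.

Set Implicit Arguments.
Unset Strict Implicit.
Unset Printing Implicit Defensive.

(** * Differentiation rules and the fundamental theorem of calculus on a segment *)

Section calculus.
Context {R : realType}.
Implicit Types (a b x : R) (f g F : R -> R).

Local Notation mu := (@lebesgue_measure R).

Lemma within_continuous_itv a b f :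
  (forall x, a <= x <= b -> {for x, continuous f}) ->
  {within `[a, b], continuous f}.
Proof.
move=> cf; apply: continuous_in_subspaceT => x.
by rewrite inE/= in_itv/= => /cf.
Qed.

Lemma continuous_itv_integrable a b f :
  (forall x, a <= x <= b -> {for x, continuous f}) ->
  mu.-integrable `[a, b] (EFin \o f).
Proof.
move=> /within_continuous_itv cf.
exact: continuous_compact_integrable (@segment_compact R a b) cf.
Qed.

Lemma integrable_EFinZl (D : set R) (c : R) f : measurable D ->
  mu.-integrable D (EFin \o f) ->
  mu.-integrable D (EFin \o (fun t => c * f t)).
Proof.
move=> mD fi; rewrite (_ : _ \o _ = fun t => (c%:E * (EFin \o f) t)%E).
  exact: integrableZl.
by apply/funext => t /=; rewrite EFinM.
Qed.

Lemma is_derive_continuous F x (d : R) :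
  is_derive x 1 F d -> {for x, continuous F}.
Proof.
by case=> dF _; apply: differentiable_continuous; exact/derivable1_diffP.
Qed.

Lemma is_derive1_eq f x (d d' : R) :
  is_derive x 1 f d -> d = d' -> is_derive x 1 f d'.
Proof. by move=> ? <-. Qed.

Lemma is_derive1M f g x (df dg : R) : is_derive x 1 f df -> is_derive x 1 g dg ->
  is_derive x 1 (fun t => f t * g t) (df * g x + f x * dg).
Proof.
move=> df' dg'.
rewrite (_ : df * g x + f x * dg = f x *: (dg : R^o) + g x *: (df : R^o)).
  exact: (is_deriveM df' dg').
by rewrite /GRing.scale/= addrC (mulrC df).
Qed.

Lemma is_derive1D f g x (df dg : R) : is_derive x 1 f df -> is_derive x 1 g dg ->
  is_derive x 1 (fun t => f t + g t) (df + dg).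
Proof. by move=> df' dg'; exact: (is_deriveD df' dg'). Qed.

Lemma is_derive1Ml c f x (df : R) : is_derive x 1 f df ->
  is_derive x 1 (fun t => c * f t) (c * df).
Proof. by move=> df'; exact: (is_deriveZ c df'). Qed.

Lemma is_derive1_chain f g x (df dg : R) :
  is_derive (g x) 1 f df -> is_derive x 1 g dg ->
  is_derive x 1 (fun t => f (g t)) (df * dg).
Proof. by move=> df' dg'; exact: (is_derive1_comp df' dg'). Qed.

Lemma is_derive1_expRN x : is_derive x 1 (fun t => expR (- t)) (- expR (- x)).
Proof.
apply: (is_derive1_eq (is_derive1_chain (is_derive_expR _) (is_deriveNid x 1))).
by rewrite mulrN1.
Qed.

Lemma is_derive1_expRZ (c x : R) :
  is_derive x 1 (fun t => expR (c * t)) (c * expR (c * x)).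
Proof.
have dc : is_derive x 1 (fun t => c * t) (c * 1) by exact: is_derive1Ml.
apply: (is_derive1_eq (is_derive1_chain (is_derive_expR _) dc)).
by rewrite mulr1 mulrC.
Qed.

Lemma Rintegral_is_derive a b f F : a <= b ->
  (forall x, a <= x <= b -> is_derive x 1 F (f x)) ->
  (forall x, a <= x <= b -> {for x, continuous f}) ->
  \int[mu]_(x in `[a, b]) f x = F b - F a.
Proof.
rewrite le_eqVlt => /predU1P[<- _ _|ab dF cf].
  by rewrite set_itv1 Rintegral_set1 subrr.
have cF x : a <= x <= b -> {for x, continuous F}.
  by move=> /dF; exact: is_derive_continuous.
rewrite /Rintegral (@continuous_FTC2 _ f F a b)//.
- exact: within_continuous_itv.
- split.
  + move=> x; rewrite in_itv/= => /andP[ax xb].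
    by case: (dF x); rewrite ?(ltW ax) ?(ltW xb).
  + by apply: cvg_at_right_filter; apply: cF; rewrite lexx ltW.
  + by apply: cvg_at_left_filter; apply: cF; rewrite lexx ltW.
- move=> x; rewrite in_itv/= => /andP[ax xb].
  by rewrite derive1E; case: (dF x); rewrite ?(ltW ax) ?(ltW xb).
Qed.

End calculus.

(** * Euler's integral: functional equation and positivity *)

Section gamma_function.
Context {R : realType}.
Implicit Types (x t : R).

Local Notation mu := (@lebesgue_measure R).

Definition gamma_integrand x t : R := t `^ (x - 1) * expR (- t).

Lemma GammaE x :
  Gamma x = \int[mu]_(t in `]0, +oo[) gamma_integrand x t.
Proof. by []. Qed.

(** With s = t / (2 x), the inequality s <= 1 + s <= exp s raised to the power x gives s^x <= exp (x
    s) = exp (t / 2). *)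
Lemma powR_le_expR x t : 0 < x -> 0 <= t ->
  t `^ x <= (2 * x) `^ x * expR (t / 2).
Proof.
move=> x0 t0; have x20 : 0 < 2 * x by rewrite mulr_gt0.
have -> : t = (2 * x) * (t / (2 * x)) by rewrite mulrC divfK ?gt_eqF.
have s0 : 0 <= t / (2 * x) by rewrite divr_ge0// ltW.
move: (t / (2 * x)) s0 => s s0.
rewrite powRM ?(ltW x20)// ler_wpM2l ?powR_ge0//.
have -> : 2 * x * s / 2 = x * s by field.
apply: (@le_trans _ _ (expR s `^ x)).
  apply: ge0_ler_powR; rewrite ?nnegrE ?expR_ge0// ?(ltW x0)//.
  by apply: le_trans (expR_ge1Dx s); rewrite lerDr.
by rewrite /powR gt_eqF ?expR_gt0// expRK.
Qed.

Lemma gamma_integrand_ge0 x t : 0 <= gamma_integrand x t.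
Proof. by rewrite mulr_ge0 ?powR_ge0 ?expR_ge0. Qed.

Lemma measurable_gamma_integrand x D : measurable_fun D (gamma_integrand x).
Proof.
apply: measurable_funTS; apply: measurable_funM => //.
by apply: measurableT_comp => //; exact: measurable_funN.
Qed.

Lemma continuous_gamma_integrand x t : 0 < t ->
  {for t, continuous (gamma_integrand x)}.
Proof.
move=> t0; apply: is_derive_continuous.
exact: (is_derive1M (is_derive1_powR (x - 1) t0) (is_derive1_expRN t)).
Qed.

Lemma integrable_expRN (c : R) : 0 < c ->
  mu.-integrable `[0, +oo[ (EFin \o (fun t : R => expR (- c * t))).
Proof.
move=> c0; apply/integrableP; split.
  apply/measurable_EFinP/measurable_funTS.
  by apply: measurableT_comp => //; exact: measurable_funM.
under eq_integral do rewrite /= ger0_norm ?expR_ge0//.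
have dF (t : R) : is_derive t 1 (fun t : R => - c^-1 * expR (- c * t)) (expR (- c * t)).
  apply: (is_derive1_eq (is_derive1Ml _ (is_derive1_expRZ _ _))).
  by rewrite mulrA mulrNN mulVf ?gt_eqF// mul1r.
rewrite (@ge0_continuous_FTC2y R _ (fun t => - c^-1 * expR (- c * t)) 0 0)//.
- by rewrite -EFinB ltry.
- apply: continuous_subspaceT => t.
  exact: is_derive_continuous (is_derive1_expRZ _ _).
- rewrite -[X in _ --> X](mulr0 (- c^-1)); apply: cvgM; first exact: cvg_cst.
  have cy : c * t @[t --> +oo] --> +oo by exact: gt0_cvgMry c0 (@cvg_id _ +oo).
  under eq_fun do rewrite mulNr.
  exact: cvg_comp cy (@cvgr_expR R).
- by apply: cvg_at_right_filter; apply: is_derive_continuous (dF 0).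
- by move=> t _; rewrite derive1E; case: (dF t).
Qed.


(** Half of the exponential decay absorbs the power of t; the other half remains as an integrable
    majorant. *)
Lemma gamma_integrandS_le x t : 0 < x -> 0 <= t ->
  gamma_integrand (x + 1) t <= (2 * x) `^ x * expR (- 2^-1 * t).
Proof.
move=> x0 t0; rewrite /gamma_integrand addrK.
apply: (@le_trans _ _ ((2 * x) `^ x * expR (t / 2) * expR (- t))).
  by rewrite ler_wpM2r ?expR_ge0// powR_le_expR.
rewrite -mulrA -expRD ler_wpM2l ?powR_ge0// ler_expR.
lra.
Qed.

(** At x + 1 the exponent of t is positive, so there is no singularity at 0. The integral at x
    itself is reached only through the recurrence. *)
Lemma integrable_gamma_integrandS x : 0 < x ->
  mu.-integrable `]0, +oo[ (EFin \o gamma_integrand (x + 1)).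
Proof.
move=> x0; have h0 : 0 < 2^-1 :> R by rewrite invr_gt0.
have half := integrable_expRN h0.
have : mu.-integrable `]0, +oo[
    (EFin \o (fun t => (2 * x) `^ x * expR (- 2^-1 * t))).
  apply: (@integrableS _ _ _ mu `[0, +oo[) => //.
    by apply: subset_itvr; rewrite bnd_simp.
  exact: integrable_EFinZl.
apply: le_integrable => //.
  by apply/measurable_EFinP; exact: measurable_gamma_integrand.
move=> t; rewrite /= in_itv/= andbT => t0.
rewrite lee_fin !ger0_norm; last 2 first.
- by rewrite mulr_ge0 ?powR_ge0 ?expR_ge0.
- exact: gamma_integrand_ge0.
exact/gamma_integrandS_le/ltW.
Qed.

(** The segments [1 / (n+1), n+1] exhaust the open half-line; on each of them the integrand is
    continuous for every exponent. *)
Let B (n : nat) : R := n.+1%:R.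

Let B_ge1 n : 1 <= B n. Proof. by rewrite ler1n. Qed.

Let Binv_gt0 n : 0 < (B n)^-1.
Proof. by rewrite invr_gt0 (lt_le_trans _ (B_ge1 n)). Qed.

Let Binv_le n : (B n)^-1 <= B n.
Proof. by rewrite (le_trans _ (B_ge1 n))// invf_le1 ?(lt_le_trans _ (B_ge1 n)). Qed.

Lemma bigcup_itv_inv : `]0, +oo[%classic = \bigcup_n `[(B n)^-1, B n]%classic.
Proof.
apply/seteqP; split => t /=; last first.
  by case=> n _ /=; rewrite !in_itv/= => /andP[tn _]; rewrite (lt_le_trans _ tn).
rewrite in_itv/= andbT => t0.
(* An integer above the sum exceeds both t and its inverse, so one index serves both end points. *)
have /archi_boundP : 0 <= t + t^-1 by rewrite addr_ge0 ?invr_ge0// ltW.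
set n := Num.bound _ => tn; exists n => //=.
have ti0 : 0 < t^-1 by rewrite invr_gt0.
have nB : n%:R <= B n by rewrite ler_nat.
have tB : t + t^-1 <= B n by exact: le_trans (ltW tn) nB.
rewrite in_itv/=; apply/andP; split; last by lra.
by rewrite -[leRHS]invrK lef_pV2 ?posrE ?(lt_le_trans _ (B_ge1 n))//; lra.
Qed.

(** Monotone convergence, taken in the extended reals: it applies before the limit is known to be
    finite. *)
Lemma cvg_truncated_gamma x :
  (\int[mu]_(t in `[(B n)^-1, B n]) gamma_integrand x t)%:E @[n --> \oo] -->
  (\int[mu]_(t in `]0%R, +oo[) (gamma_integrand x t)%:E)%E.
Proof.
rewrite bigcup_itv_inv.
have mono : nondecreasing_seq (fun n => `[(B n)^-1, B n]%classic).
  move=> m n mn; rewrite subsetEset => t /=; rewrite !in_itv/= => /andP[mt tm].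
  rewrite (le_trans _ mt) ?(le_trans tm) ?ler_nat//.
  by rewrite lef_pV2 ?posrE ?(lt_le_trans _ (B_ge1 _))// ler_nat.
rewrite (_ : (fun n => _) = fun n =>
    (\int[mu]_(t in `[((B n)^-1)%R, B n]) (gamma_integrand x t)%:E)%E).
  apply: ge0_nondecreasing_set_cvg_integral => //.
    by move=> n; apply/measurable_EFinP; exact: measurable_gamma_integrand.
  by move=> n t _; rewrite lee_fin gamma_integrand_ge0.
apply/funext => n; rewrite /Rintegral fineK//; apply: integrable_fin_num => //.
apply: continuous_itv_integrable => t /andP[nt _].
by apply: continuous_gamma_integrand; rewrite (lt_le_trans (Binv_gt0 n)).
Qed.

(* The derivative of [t^x exp(-t)] is [x t^(x-1) exp(-t) - t^x exp(-t)]. *)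
Lemma truncated_gamma_rec x n : 0 < x ->
  \int[mu]_(t in `[(B n)^-1, B n]) gamma_integrand x t =
  x^-1 * (\int[mu]_(t in `[(B n)^-1, B n]) gamma_integrand (x + 1) t
          + (B n `^ x * expR (- B n) - (B n)^-1 `^ x * expR (- (B n)^-1))).
Proof.
move=> x0.
have pos t : (B n)^-1 <= t <= B n -> 0 < t.
  by move=> /andP[nt _]; rewrite (lt_le_trans (Binv_gt0 n)).
pose h t := x * gamma_integrand x t - gamma_integrand (x + 1) t.
have ig y : mu.-integrable `[(B n)^-1, B n] (EFin \o gamma_integrand y).
  apply: continuous_itv_integrable => t tn.
  by apply: continuous_gamma_integrand; exact: pos.
have dF t : (B n)^-1 <= t <= B n ->
    is_derive t 1 (fun t => t `^ x * expR (- t)) (h t).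
  move=> /pos t0.
  apply: (is_derive1_eq (is_derive1M (is_derive1_powR x t0) (is_derive1_expRN t))).
  by rewrite /h /gamma_integrand addrK mulrN mulrA.
have ch t : (B n)^-1 <= t <= B n -> {for t, continuous h}.
  move=> /pos t0; apply: continuousB.
    by apply: continuousM; [exact: cvg_cst|exact: continuous_gamma_integrand].
  exact: continuous_gamma_integrand.
have /= <- := Rintegral_is_derive (Binv_le n) dF ch.
have igx : mu.-integrable `[(B n)^-1, B n] (EFin \o (fun t => x * gamma_integrand x t)).
  exact: integrable_EFinZl.
by rewrite RintegralB// RintegralZl// addrC subrK mulKf ?gt_eqF.
Qed.

(** At the upper end the exponential wins over the power; at the lower end the power tends to 0
    because x > 0. *)
Lemma gamma_boundary_cvg0 x : 0 < x ->
  B n `^ x * expR (- B n) - (B n)^-1 `^ x * expR (- (B n)^-1) @[n --> \oo] --> 0.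
Proof.
move=> x0; have B0 n : 0 < B n by rewrite (lt_le_trans _ (B_ge1 n)).
have cB : (B n)^-1 @[n --> \oo] --> 0 by exact: cvg_harmonic.
have nB : \forall n \near \oo, 0 < B n by near=> n; exact: B0.
have By : B n @[n --> \oo] --> +oo by have := (gtr0_cvgV0 nB).1 cB; apply.
rewrite -[X in _ --> X]subr0; apply: cvgB.
- have h : (2 * x) `^ x * expR (- (2^-1 * B n)) @[n --> \oo] --> 0.
    rewrite -[X in _ --> X](mulr0 ((2 * x) `^ x)); apply: cvgM; first exact: cvg_cst.
    have h0 : 0 < 2^-1 :> R by rewrite invr_gt0.
    have cy : (2^-1 : R) * t @[t --> +oo] --> +oo by exact: gt0_cvgMry h0 (@cvg_id _ +oo).
    have e0 : expR (- (2^-1 * t)) @[t --> +oo] --> (0 : R).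
      exact: cvg_comp cy (@cvgr_expR R).
    exact: cvg_comp By e0.
  apply: (squeeze_cvgr _ (cvg_cst 0) h); apply: nearW => n.
  rewrite mulr_ge0 ?powR_ge0 ?expR_ge0//=.
  by have := gamma_integrandS_le x0 (ltW (B0 n)); rewrite /gamma_integrand addrK mulNr.
- have h : (B n)^-1 `^ x @[n --> \oo] --> 0.
    have /cvg_at_rightP := powR_cvg0 x0; apply; split => // n.
  apply: (squeeze_cvgr _ (cvg_cst 0) h); apply: nearW => n.
  rewrite mulr_ge0 ?powR_ge0 ?expR_ge0//=.
  by rewrite ler_piMr ?powR_ge0// -expR0 ler_expR oppr_le0 ltW.
Unshelve. all: by end_near. Qed.

(** The limit of [truncated_gamma_rec]. Its right-hand side has a finite limit by integrability at x
    + 1, and uniqueness of limits in the extended reals makes the integral at x finite with the same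
    value. *)
Lemma GammaS x : 0 < x -> Gamma (x + 1) = x * Gamma x.
Proof.
move=> x0; have iS := integrable_gamma_integrandS x0.
have fS : (\int[mu]_(t in `]0%R, +oo[) (gamma_integrand (x + 1) t)%:E \is a fin_num)%E.
  exact: integrable_fin_num.
have cS := @cvg_truncated_gamma (x + 1).
rewrite -(fineK fS) in cS.
have h : (\int[mu]_(t in `[(B n)^-1, B n]) gamma_integrand x t)%:E @[n --> \oo] -->
  (x^-1 * Gamma (x + 1))%:E.
  apply: cvg_EFin; first by apply: nearW.
  under eq_fun do rewrite /= truncated_gamma_rec//.
  apply: cvgM; first exact: cvg_cst.
  rewrite -[X in _ --> X]addr0; apply: cvgD; last exact: gamma_boundary_cvg0.
  exact: (fine_cvg cS).
have e := cvg_unique (@ereal_hausdorff R) (@cvg_truncated_gamma x) h.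
by rewrite (GammaE x) /Rintegral e/= mulVKf ?gt_eqF.
Qed.

(** On [1, 2] the power is at least 1 and the exponential at least exp (-2), which bounds the whole
    integral from below. *)
Lemma GammaS_gt0 x : 0 < x -> 0 < Gamma (x + 1).
Proof.
move=> x0; have iS := integrable_gamma_integrandS x0.
have sub : (`[1, 2]%classic : set R) `<=` `]0, +oo[%classic.
  move=> t /=; rewrite !in_itv/= andbT => /andP[t1 _].
  by rewrite (lt_le_trans _ t1).
have i12 : mu.-integrable `[1, 2] (EFin \o gamma_integrand (x + 1)).
  exact: integrableS iS.
have ic : mu.-integrable `[1, 2] (EFin \o (fun=> expR (- 2) : R)).
  by apply: continuous_itv_integrable => t _; exact: cvg_cst.
apply: (@lt_le_trans _ _ (\int[mu]_(t in `[1, 2]) (expR (- 2) : R))).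
  rewrite Rintegral_cst//= lebesgue_measure_itv/= lte_fin ifT; last by lra.
  by rewrite mulr_gt0 ?expR_gt0//=; lra.
apply: (@le_trans _ _ (\int[mu]_(t in `[1, 2]) gamma_integrand (x + 1) t)).
  apply: le_Rintegral => // t /=; rewrite in_itv/= => /andP[t1 t2].
  rewrite /gamma_integrand addrK -[leLHS]mul1r ler_pM ?expR_ge0//.
    by rewrite -(powRr0 t) ler_powR// ltW.
  by rewrite ler_expR lerN2.
rewrite GammaE /Rintegral fine_le//; try exact: integrable_fin_num.
apply: ge0_subset_integral => //.
  by apply/measurable_EFinP; exact: measurable_gamma_integrand.
by move=> t _; rewrite lee_fin gamma_integrand_ge0.
Qed.

Lemma Gamma_gt0 x : 0 < x -> 0 < Gamma x.
Proof. by move=> x0; have := GammaS_gt0 x0; rewrite GammaS// pmulr_rgt0. Qed.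

End gamma_function.

(** * Entire power series and their termwise derivatives *)

Section power_series.
Context {R : realType}.
Implicit Types (c : R^nat) (x y : R).

(** The power of 2 accommodates 1 / (k + alpha + 1) <= 2 in the Bessel recurrence. The class is
    closed under formal differentiation, and its members converge everywhere by comparison with the
    exponential series. *)
Definition factorially_bounded c :=
  exists C : R, forall k, `|c k| <= C * (2 ^+ k / k`!%:R).

Lemma factorially_bounded_diffs c :
  factorially_bounded c -> factorially_bounded (pseries_diffs c).
Proof.
move=> [C cC]; exists (2 * C) => k; rewrite /pseries_diffs normrM normr_nat.
apply: (@le_trans _ _ (k.+1%:R * (C * (2 ^+ k.+1 / k.+1`!%:R)))).
  by rewrite ler_wpM2l.
rewrite le_eqVlt; apply/orP; left; apply/eqP.
rewrite factS natrM exprS.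
by field; rewrite pnatr_eq0 -lt0n fact_gt0 nat1r pnatr_eq0.
Qed.

Lemma factorially_bounded_cvg c x : factorially_bounded c -> cvgn (pseries c x).
Proof.
move=> [C cC]; apply: normed_cvg.
have C0 : 0 <= C.
  by have := le_trans (normr_ge0 _) (cC 0%N); rewrite expr0 fact0 divr1 mulr1.
apply: (@series_le_cvg _ _ (fun k => C * exp_coeff (2 * `|x|) k)).
- by move=> k /=.
- by move=> k /=; rewrite mulr_ge0// exp_coeff_ge0// mulr_ge0.
- move=> k /=; rewrite normrM normrX /exp_coeff/= exprMn.
  apply: (@le_trans _ _ (C * (2 ^+ k / k`!%:R) * `|x| ^+ k)).
    by rewrite ler_wpM2r ?exprn_ge0.
  by rewrite le_eqVlt; apply/orP; left; apply/eqP; ring.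
- by apply: is_cvg_seriesZ; exact: is_cvg_series_exp_coeff.
Qed.

Lemma factorially_bounded_is_derive c x : factorially_bounded c ->
  is_derive x 1 (fun y => limn (pseries c y)) (limn (pseries (pseries_diffs c) x)).
Proof.
move=> cC; have dC := factorially_bounded_diffs cC.
apply: (@pseries_snd_diffs _ c (`|x| + 1)); try exact: factorially_bounded_cvg.
  exact/factorially_bounded_cvg/factorially_bounded_diffs.
by rewrite [ltRHS]ger0_norm ?addr_ge0// ltrDl.
Qed.

End power_series.

(** * Coefficients of the normalized Bessel function *)

Section bessel_function.
Context {R : realType}.
Variable alpha : R.
Hypothesis halpha : - (1 / 2) <= alpha.

Let a1_gt0 : 0 < alpha + 1. Proof. by have := halpha; lra. Qed.

(** The coefficient of (z^2 / 4)^k in j_alpha(z). *)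
Definition bessel_coef (k : nat) : R :=
  (-1) ^+ k * Gamma (alpha + 1) / (k`!%:R * Gamma (k%:R + alpha + 1)).

Lemma bessel_coef0 : bessel_coef 0 = 1.
Proof.
rewrite /bessel_coef fact0 expr0 !mul1r add0r divff// gt_eqF//.
exact: Gamma_gt0.
Qed.

Lemma bessel_coefS k :
  bessel_coef k.+1 * (k.+1%:R * (k%:R + alpha + 1)) = - bessel_coef k.
Proof.
have ka : 0 < k%:R + alpha + 1 :> R by rewrite -addrA ltr_wpDl.
have G0 := Gamma_gt0 ka.
rewrite /bessel_coef (_ : k.+1%:R + alpha + 1 = (k%:R + alpha + 1) + 1).
  rewrite (GammaS ka) factS natrM exprS; field.
  by rewrite !gt_eqF ?ltr0n ?fact_gt0 ?nat1r.
by rewrite -natr1; ring.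
Qed.

Lemma bessel_coef_bounded : factorially_bounded bessel_coef.
Proof.
exists 1; elim=> [|k IH].
  by rewrite bessel_coef0 normr1 expr0 fact0 divr1 mulr1.
(* This is where alpha >= -1/2 enters: one step of the recurrence gains at least the factor (k + 1)
   / 2 in the denominator. *)
have ka : 1 / 2 <= k%:R + alpha + 1 :> R.
  by have := halpha; have : 0 <= k%:R :> R by []; lra.
have ka0 : 0 < k%:R + alpha + 1 by apply: lt_le_trans ka; lra.
have /(congr1 Num.norm) := bessel_coefS k.
have q0 : 0 < k.+1%:R * (k%:R + alpha + 1) by rewrite mulr_gt0.
rewrite normrN normrM (gtr0_norm q0) => E.
rewrite -(ler_pM2r q0) E; apply: (le_trans IH).
rewrite mul1r.
rewrite mul1r exprS factS natrM.
rewrite (_ : 2 * 2 ^+ k / (k.+1%:R * k`!%:R) * (k.+1%:R * (k%:R + alpha + 1)) =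
  2 ^+ k / k`!%:R * (2 * (k%:R + alpha + 1))).
  by rewrite ler_peMr ?divr_ge0 ?exprn_ge0//; lra.
by field; rewrite !gt_eqF ?ltr0n ?fact_gt0 ?nat1r.
Qed.

End bessel_function.

(** * Bessel's equation and the identification with the given series *)

Section bessel_series.
Context {R : realType}.
Variable alpha : R.
Hypothesis halpha : - (1 / 2) <= alpha.

Let c := bessel_coef alpha.
(** In the variable y = z^2 / 4 the Bessel function is an ordinary power series; [phi1] and [phi2]
    are its first two derivatives. *)
Let phi (y : R) : R := limn (pseries c y).
Let phi1 (y : R) : R := limn (pseries (pseries_diffs c) y).
Let phi2 (y : R) : R := limn (pseries (pseries_diffs (pseries_diffs c)) y).

Let b0 : factorially_bounded c := bessel_coef_bounded halpha.
Let b1 := factorially_bounded_diffs b0.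
Let b2 := factorially_bounded_diffs b1.

(** Bessel's equation in the variable y. The coefficient of y^k is (k+1) (k + alpha + 1) c_(k+1) +
    c_k, which vanishes by [bessel_coefS], so every partial sum of the left-hand side is 0. *)
Let bessel_phi_ode y : y * phi2 y + (alpha + 1) * phi1 y + phi y = 0.
Proof.
have coef0 k : y * (k%:R * pseries_diffs c k * y ^+ k.-1) +
    (alpha + 1) * (pseries_diffs c k * y ^+ k) + c k * y ^+ k = 0.
  rewrite /pseries_diffs.
  have -> : c k = - (c k.+1 * (k.+1%:R * (k%:R + alpha + 1))).
    by rewrite bessel_coefS// opprK.
  case: k => [|k] /=; first by rewrite expr0; ring.
  by rewrite exprS; ring.
(* The series of [phi2] is taken with terms i d_i y^(i-1), where d are the coefficients of [phi1];
   after multiplication by y all three series match index by index. *)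
have h2 := pseries_diffs_equiv (factorially_bounded_cvg (x := y) b2).
have h1 : pseries (pseries_diffs c) y @ \oo --> phi1 y.
  exact: (factorially_bounded_cvg b1).
have h0 : pseries c y @ \oo --> phi y by exact: (factorially_bounded_cvg b0).
have h : (fun=> 0 : R) @ \oo --> y * phi2 y + (alpha + 1) * phi1 y + phi y.
  rewrite (_ : (fun=> _) = fun n : nat =>
      y * series (fun i => i%:R * pseries_diffs c i * y ^+ i.-1) n +
      (alpha + 1) * pseries (pseries_diffs c) y n + pseries c y n).
    apply: cvgD => //; apply: cvgD.
      by apply: cvgM => //; exact: cvg_cst.
    by apply: cvgM => //; exact: cvg_cst.
  apply/funext => n; rewrite /pseries /series/= !mulr_sumr.
  rewrite -!big_split/= big1// => k _; exact: coef0.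
by rewrite -(cvg_lim (@Rhausdorff R) h) lim_cst.
Qed.

(* An entire function that agrees with [bessel_j] on the half-line [0 <= z]. *)
Definition bessel_series (z : R) : R := phi (z ^+ 2 / 4).
Definition bessel_series' (z : R) : R := z / 2 * phi1 (z ^+ 2 / 4).
Definition bessel_series'' (z : R) : R :=
  phi1 (z ^+ 2 / 4) / 2 + z ^+ 2 / 4 * phi2 (z ^+ 2 / 4).

Let is_derive_sqr (z : R) : is_derive z 1 (fun t : R => t ^+ 2 / 4) (z / 2).
Proof.
rewrite (_ : (fun t : R => t ^+ 2 / 4) = fun t => 4^-1 * (t * t)); last first.
  by apply/funext => t; rewrite expr2 mulrC.
have dz := is_derive_id z 1.
apply: (is_derive1_eq (is_derive1Ml _ (is_derive1M dz dz))).
by field.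
Qed.

Lemma is_derive_bessel_series (z : R) : is_derive z 1 bessel_series (bessel_series' z).
Proof.
have := is_derive1_chain (factorially_bounded_is_derive _ b0) (is_derive_sqr z).
by move/is_derive1_eq; apply; rewrite mulrC.
Qed.

Lemma is_derive_bessel_series' (z : R) :
  is_derive z 1 bessel_series' (bessel_series'' z).
Proof.
have h := is_derive1_chain (factorially_bounded_is_derive _ b1) (is_derive_sqr z).
have h2 : is_derive z 1 (fun t : R => t / 2) (2^-1).
  rewrite (_ : (fun t => t / 2) = fun t => 2^-1 * t).
    by apply: (is_derive1_eq (is_derive1Ml _ (is_derive_id z 1))); rewrite mulr1.
  by apply/funext => t; rewrite mulrC.
apply: (is_derive1_eq (is_derive1M h2 h)).
by rewrite /bessel_series'' /phi1 /phi2; field.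
Qed.

Lemma bessel_series_ode z : z * bessel_series'' z =
  - ((2 * alpha + 1) * bessel_series' z + z * bessel_series z).
Proof.
have := bessel_phi_ode (z ^+ 2 / 4).
rewrite /bessel_series'' /bessel_series' /bessel_series.
set y := z ^+ 2 / 4; set p := phi y; set p1 := phi1 y; set p2 := phi2 y => E.
have -> : p = - (y * p2 + (alpha + 1) * p1).
  by apply/eqP; rewrite -subr_eq0 opprK; apply/eqP; rewrite -[RHS]E; ring.
by field.
Qed.

Lemma bessel_series0 : bessel_series 0 = 1.
Proof.
rewrite /bessel_series expr0n mul0r; apply: cvg_lim => //.
(* The partial sum without terms is 0; shifting the index by one leaves the constant sequence 1. *)
rewrite -cvg_shiftS (_ : (fun n => _) = cst 1); first exact: cvg_cst.
apply/funext => n; rewrite /pseries /series/= big_nat_recl//= expr0 mulr1.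
rewrite /c bessel_coef0// big1 ?addr0// => k _.
by rewrite expr0n mulr0.
Qed.

Lemma bessel_jE (z : R) : 0 <= z -> bessel_j alpha z = bessel_series z.
Proof.
rewrite le_eqVlt => /predU1P[<-|z0].
  by rewrite /bessel_j eqxx bessel_series0.
rewrite /bessel_j gt_eqF// /besselJ.
have h0 : 0 < z / 2 by rewrite divr_gt0.
have G0 : 0 < Gamma (alpha + 1) by apply: Gamma_gt0; have := halpha; lra.
set K := _ * _ `^ _.
have K0 : K != 0 by rewrite gt_eqF// mulr_gt0// powR_gt0.
(* The power (z/2)^(2k + alpha) splits into (z^2/4)^k and (z/2)^alpha; the latter, together with the
   missing factor Gamma(alpha + 1), is accounted for by the inverse of [K]. *)
rewrite (_ : (fun k : nat => _) = fun k => K^-1 * (c k * (z ^+ 2 / 4) ^+ k)).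
  rewrite (_ : limn _ = K^-1 * bessel_series z) ?mulVKf//.
  apply: cvg_lim => //.
  rewrite (_ : series _ = fun n => K^-1 * pseries c (z ^+ 2 / 4) n).
    by apply: cvgM; [exact: cvg_cst|exact: factorially_bounded_cvg].
  by apply/funext => n; rewrite /pseries /series/= mulr_sumr.
apply/funext => k.
rewrite powRD; last by rewrite (gt_eqF h0) implybT.
have e2 : 2 * k%:R = (2 * k)%:R :> R by rewrite natrM.
rewrite e2 powR_mulrn ?(ltW h0)// exprM.
have -> : (z / 2) ^+ 2 = z ^+ 2 / 4 by field.
rewrite /K /c /bessel_coef powRN.
field.
rewrite !gt_eqF ?powR_gt0 ?ltr0n ?fact_gt0//.
apply: Gamma_gt0; rewrite -addrA ltr_wpDl//; have := halpha; lra.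
Qed.

End bessel_series.

(** * Decay of j' at infinity and size of j - 1 near 0 *)

Section bessel_estimates.
Context {R : realType}.
Implicit Types (x z : R).

(* The energy [u^2 + u'^2] of [u = z^a B], which solves
   [u'' = (m / z^2 - 1) u], is almost conserved: multiplied by [exp (|m| / z)] it
   is nonincreasing. *)
Lemma bessel_equation_decay (a : R) (B B' B'' : R -> R) : 0 <= a ->
  (forall z, 0 < z -> is_derive z 1 B (B' z)) ->
  (forall z, 0 < z -> is_derive z 1 B' (B'' z)) ->
  (forall z, 0 < z -> z * B'' z = - (2 * a * B' z + z * B z)) ->
  exists2 C : R, 0 <= C & forall z, 1 <= z -> `|B' z| <= C * z `^ (- a).
Proof.
move=> a0 dB dB' ode.
(* Multiplying by z^a removes the first-order term of the equation; [v] is the derivative of [u],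
   and [m] is the coefficient left over. *)
pose u z := z `^ a * B z.
pose v z := z `^ a * (B' z + a * (B z * z^-1)).
pose m := a * (a - 1).
pose W z := (u z * u z + v z * v z) * expR (`|m| * z^-1).
have dV (z : R) : 0 < z -> is_derive z 1 (fun t : R => t^-1) (- z ^- 2).
  move=> z0; have z0' : z != 0 by rewrite gt_eqF.
  have := @is_deriveV _ id z 1 1 z0' (is_derive_id z 1).
  by move/is_derive1_eq; apply; rewrite /GRing.scale/= mulr1.
have dP (z : R) : 0 < z -> is_derive z 1 (fun t : R => t `^ a) (a * z `^ a / z).
  move=> z0; apply: (is_derive1_eq (is_derive1_powR a z0)).
  by rewrite powRB ?(gt_eqF z0) ?implybT// powRr1 ?(ltW z0)// mulrA.
have du z : 0 < z -> is_derive z 1 u (v z).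
  move=> z0; apply: (is_derive1_eq (is_derive1M (dP z z0) (dB z z0))).
  by rewrite /v; field; rewrite gt_eqF.
have dv z : 0 < z -> is_derive z 1 v ((m / z ^+ 2 - 1) * u z).
  move=> z0.
  have d1 := is_derive1M (dB z z0) (dV z z0).
  have d2 := is_derive1D (dB' z z0) (is_derive1Ml a d1).
  apply: (is_derive1_eq (is_derive1M (dP z z0) d2)).
  have -> : B'' z = - (2 * a * B' z / z + B z).
    have z0' : z != 0 by rewrite gt_eqF.
    by apply: (mulfI z0'); rewrite ode//; field.
  by rewrite /m /u; field; rewrite gt_eqF.
(* The derivative of u^2 + v^2 is 2 m u v / z^2, and the exponential contributes the term with -|m|.
   The sign follows from 2 |u v| <= u^2 + v^2. *)
pose W' z := expR (`|m| * z^-1) / z ^+ 2 *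
  (2 * m * (u z * v z) - `|m| * (u z * u z + v z * v z)).
have dW z : 0 < z -> is_derive z 1 W (W' z).
  move=> z0.
  have d1 := is_derive1D (is_derive1M (du z z0) (du z z0))
    (is_derive1M (dv z z0) (dv z z0)).
  have d2 := is_derive1_chain (is_derive_expR _) (is_derive1Ml `|m| (dV z z0)).
  apply: (is_derive1_eq (is_derive1M d1 d2)).
  by rewrite /W'; field; rewrite gt_eqF.
have W'le0 z : 0 < z -> W' z <= 0.
  move=> z0; apply: mulr_ge0_le0.
    by rewrite divr_ge0 ?expR_ge0// exprn_ge0// ltW.
  rewrite subr_le0; apply: (le_trans (ler_norm _)).
  have -> : `|2 * m * (u z * v z)| = `|m| * (2 * (`|u z| * `|v z|)).
    by rewrite !normrM normr_nat; ring.
  rewrite ler_wpM2l//.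
  have := sqr_ge0 (`|u z| - `|v z|).
  rewrite sqrrB !real_normK ?num_real// !expr2.
  lra.
have WleW1 z : 1 <= z -> W z <= W 1.
  rewrite le_eqVlt => /predU1P[<-//|z1].
  have [||x] := @MVT R W W' 1 z z1.
  - by move=> x; rewrite in_itv/= => /andP[x1 _]; apply: dW; rewrite (lt_trans _ x1).
  - apply: within_continuous_itv => x /andP[x1 _].
    by apply: is_derive_continuous; apply: dW; rewrite (lt_le_trans _ x1).
  - rewrite in_itv/= => /andP[x1 _] /eqP; rewrite subr_eq => /eqP ->.
    rewrite gerDr mulr_le0_ge0 ?W'le0 ?(lt_trans _ x1)//.
    by rewrite subr_ge0 ltW.
(* The exponential factor in [W] is at least 1, so [W 1] bounds the energy itself and [D] bounds
   both |u| and |v|. *)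
pose D := Num.sqrt (W 1).
have uvD z : 1 <= z -> `|u z| <= D /\ `|v z| <= D.
  move=> z1; have z0 : 0 < z by rewrite (lt_le_trans _ z1).
  have E : u z * u z + v z * v z <= W 1.
    apply: le_trans (WleW1 z z1).
    rewrite ler_peMr//; first by rewrite addr_ge0// -expr2 sqr_ge0.
    by rewrite -expR0 ler_expR mulr_ge0// invr_ge0 ltW.
  by split; rewrite -sqrtr_sqr ler_wsqrtr// (le_trans _ E)// expr2 ?lerDl ?lerDr
    -expr2 sqr_ge0.
(* From z^a B' = v - a u / z, with 1 / z <= 1. *)
exists (D * (1 + a)); first by rewrite mulr_ge0 ?sqrtr_ge0// addr_ge0.
move=> z z1; have z0 : 0 < z by rewrite (lt_le_trans _ z1).
have P0 : 0 < z `^ a by rewrite powR_gt0.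
have [uD vD] := uvD z z1.
rewrite powRN ler_pdivlMr//.
have -> : `|B' z| * z `^ a = `|v z - a * (u z / z)|.
  rewrite -{1}(gtr0_norm P0) -normrM; congr `|_|.
  by rewrite /v /u; field; rewrite gt_eqF.
apply: (le_trans (ler_normB _ _)).
rewrite mulrDr mulr1 lerD// normrM (ger0_norm a0) mulrC ler_wpM2r//.
rewrite normrM (le_trans _ uD)// ler_piMr//.
by rewrite ger0_norm ?invf_le1// invr_ge0 ltW.
Qed.

(** The case a = alpha + 1/2, for which 2 a is the first-order coefficient 2 alpha + 1 of Bessel's
    equation. *)
Lemma bessel_series'_decay (alpha : R) : - (1 / 2) <= alpha ->
  exists2 C : R, 0 <= C &
    forall z, 1 <= z -> `|bessel_series' alpha z| <= C * z `^ (- (alpha + 1 / 2)).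
Proof.
move=> h; apply: (@bessel_equation_decay _ (bessel_series alpha) _ (bessel_series'' alpha)).
- lra.
- by move=> z _; exact: is_derive_bessel_series.
- by move=> z _; exact: is_derive_bessel_series'.
- by move=> z z0; rewrite bessel_series_ode//; field.
Qed.

Lemma continuous_bessel_series (alpha z : R) : - (1 / 2) <= alpha ->
  {for z, continuous (bessel_series alpha)}.
Proof. by move=> h; exact: is_derive_continuous (is_derive_bessel_series h z). Qed.

Lemma continuous_bessel_series' (alpha z : R) : - (1 / 2) <= alpha ->
  {for z, continuous (bessel_series' alpha)}.
Proof. by move=> h; exact: is_derive_continuous (is_derive_bessel_series' h z). Qed.

(** Mean value theorem on [0, z], with the maximum of |j'| over [0, 1] as constant. *)
Lemma bessel_series_near0 (alpha : R) : - (1 / 2) <= alpha ->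
  exists2 C : R, 0 <= C &
    forall z, 0 <= z <= 1 -> `|bessel_series alpha z - 1| <= C * z.
Proof.
move=> h.
have [|c _ cmax] := @EVT_max R (fun z => `|bessel_series' alpha z|) 0 1 ler01.
  apply: within_continuous_itv => z _; apply: continuous_comp.
    exact: continuous_bessel_series'.
  exact: norm_continuous.
exists `|bessel_series' alpha c| => // z /andP[z0 z1].
have [||x] := @MVT_segment R (bessel_series alpha) (bessel_series' alpha) 0 z z0.
- by move=> x _; exact: is_derive_bessel_series.
- by apply: within_continuous_itv => x _; exact: continuous_bessel_series.
rewrite bessel_series0// subr0 in_itv/= => /andP[x0 xz] ->.
rewrite normrM (ger0_norm z0) ler_wpM2r// cmax// in_itv/= x0/=.
exact: le_trans z1.
Qed.

End bessel_estimates.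

(** * Integrability and norm estimates on segments *)

Section integration_tools.
Context {R : realType}.
Implicit Types (a b c x y t : R) (f g h u w F G V : R -> R).

Local Notation mu := (@lebesgue_measure R).

Lemma integrable_itvS a b c d f : a <= c -> d <= b ->
  mu.-integrable `[a, b] (EFin \o f) -> mu.-integrable `[c, d] (EFin \o f).
Proof.
move=> ac db; apply: integrableS => // t /=.
rewrite !in_itv/= => /andP[ct td].
by rewrite (le_trans ac ct) (le_trans td db).
Qed.

Lemma Rintegral_itv_cat a b c f : a <= b -> b <= c ->
  mu.-integrable `[a, c] (EFin \o f) ->
  \int[mu]_(t in `[a, c]) f t =
  \int[mu]_(t in `[a, b]) f t + \int[mu]_(t in `[b, c]) f t.
Proof.
move=> ab bc fi.
have := @Rintegral_itvB _ f (BLeft a) (BRight c) b fi.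
rewrite !bnd_simp => /(_ ab bc).
rewrite Rintegral_itv_obnd_cbnd => [<-|]; first by rewrite addrC subrK.
apply: integrableS fi => // t /=.
by rewrite !in_itv/= => /andP[bt ->]; rewrite (le_trans ab (ltW bt)).
Qed.

Lemma integrable_EFinB (D : set R) f g : measurable D ->
  mu.-integrable D (EFin \o f) -> mu.-integrable D (EFin \o g) ->
  mu.-integrable D (EFin \o (fun t => f t - g t)).
Proof.
move=> mD fi gi.
rewrite (_ : _ \o _ = (EFin \o f) \- (EFin \o g))%E; last exact/funext.
exact: integrableB.
Qed.

Lemma integrable_setU_disjoint (A B : set R) (f : R -> R) :
  measurable A -> measurable B -> [disjoint A & B] ->
  mu.-integrable A (EFin \o f) -> mu.-integrable B (EFin \o f) ->
  mu.-integrable (A `|` B) (EFin \o f).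
Proof.
move=> mA mB AB /integrableP[fA iA] /integrableP[fB iB]; apply/integrableP.
have mf : measurable_fun (A `|` B) (EFin \o f) by apply/measurable_funU.
split => //; rewrite ge0_integral_setU//; first by rewrite lte_add_pinfty.
exact: measurableT_comp.
Qed.

Lemma integrable_mul_continuous a b f g :
  mu.-integrable `[a, b] (EFin \o f) ->
  (forall t, a <= t <= b -> {for t, continuous g}) ->
  mu.-integrable `[a, b] (EFin \o (fun t => f t * g t)).
Proof.
move=> fi /within_continuous_itv cg.
rewrite (_ : _ \o _ = (EFin \o f) \* (EFin \o g))%E; last exact/funext.
apply: integrableMl => //.
  exact: subspace_continuous_measurable_fun.
have /compact_bounded[M [Mr HM]] := continuous_compact cg (@segment_compact R a b).
by exists M; split => // x /HM Hx t tab; apply: Hx; exists t.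
Qed.

Lemma le_norm_Rintegral a b f h :
  mu.-integrable `[a, b] (EFin \o f) -> mu.-integrable `[a, b] (EFin \o h) ->
  (forall t, a <= t <= b -> `|f t| <= h t) ->
  `|\int[mu]_(t in `[a, b]) f t| <= \int[mu]_(t in `[a, b]) h t.
Proof.
move=> fi hi fh; apply: le_trans (le_normr_Rintegral _ fi) _ => //.
by apply: le_Rintegral => //; exact: (integrable_norm fi).
Qed.

Lemma norm_Rintegral_le_cst a b f (M : R) : a <= b ->
  mu.-integrable `[a, b] (EFin \o f) ->
  (forall t, a <= t <= b -> `|f t| <= M) ->
  `|\int[mu]_(t in `[a, b]) f t| <= M * (b - a).
Proof.
move=> ab fi fM.
have ci : mu.-integrable `[a, b] (EFin \o (fun=> M)).
  by apply: continuous_itv_integrable => t _; exact: cvg_cst.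
apply: le_trans (le_norm_Rintegral fi ci fM) _.
rewrite Rintegral_cst//= lebesgue_measure_itv/= lte_fin.
case: ifPn => [_//|]; rewrite -leNgt => ba /=.
by rewrite (le_anti (introT andP (conj ab ba))) subrr.
Qed.

End integration_tools.

(** * Integration by parts against a function of bounded variation *)

Section integration_by_parts_bv.
Context {R : realType}.
Implicit Types (a b x y t : R) (u g w G V : R -> R).

Local Notation mu := (@lebesgue_measure R).

(** Freezing [u] at x, the left-hand side becomes the integral of (u - u x) g minus (u y - u x) G y;
    the increment of [V], which stands for a variation function of [u], controls both. *)
Lemma by_parts_step u g G V x y (K : R) : x <= y ->
  mu.-integrable `[x, y] (EFin \o u) ->
  (forall t, x <= t <= y -> is_derive t 1 G (g t)) ->
  (forall t, x <= t <= y -> {for t, continuous g}) ->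
  (forall t, x <= t <= y -> `|g t| <= K) ->
  (forall t, x <= t <= y -> `|u t - u x| <= V y - V x) ->
  `|\int[mu]_(t in `[x, y]) (u t * g t) - u y * G y + u x * G x| <=
  (`|G y| + K * (y - x)) * (V y - V x).
Proof.
move=> xy ui dG cg gK uV.
have ug := integrable_mul_continuous ui cg.
have gi := continuous_itv_integrable cg.
have ugx : mu.-integrable `[x, y] (EFin \o (fun t => u x * g t)).
  exact: integrable_EFinZl.
have E : \int[mu]_(t in `[x, y]) (u t * g t - u x * g t) =
    \int[mu]_(t in `[x, y]) (u t * g t) - u x * (G y - G x).
  by rewrite RintegralB// RintegralZl// (Rintegral_is_derive xy dG cg).
have -> : \int[mu]_(t in `[x, y]) (u t * g t) - u y * G y + u x * G x =
    \int[mu]_(t in `[x, y]) (u t * g t - u x * g t) - (u y - u x) * G y.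
  by rewrite E; ring.
have Vxy : 0 <= V y - V x.
  by apply: le_trans (uV y _); rewrite ?normr_ge0 ?xy ?lexx.
apply: (le_trans (ler_normB _ _)).
rewrite [leRHS]mulrDl [leRHS]addrC lerD//; last first.
  by rewrite normrM mulrC ler_wpM2l// uV// xy lexx.
rewrite mulrAC; apply: norm_Rintegral_le_cst => //.
  exact: integrable_EFinB.
move=> t txy; rewrite -mulrBl normrM mulrC.
by apply: ler_pM => //; [exact: gK|exact: uV].
Qed.


(* Comparing with a Riemann sum over a partition [p] avoids the integral of [G]
   with respect to [u]: the term with [K] vanishes as the mesh goes to 0, and the
   other one becomes the integral of [|G|] with respect to [V]. *)
Lemma by_parts_sum u g G V a b (K : R) (p : nat -> R) n :
  mu.-integrable `[a, b] (EFin \o u) ->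
  (forall t, a <= t <= b -> is_derive t 1 G (g t)) ->
  (forall t, a <= t <= b -> {for t, continuous g}) ->
  (forall t, a <= t <= b -> `|g t| <= K) ->
  (forall x y, a <= x -> x <= y -> y <= b -> `|u y - u x| <= V y - V x) ->
  p 0%N = a -> p n = b -> (forall i, (i < n)%N -> p i <= p i.+1) ->
  `|\int[mu]_(t in `[a, b]) (u t * g t) - u b * G b + u a * G a| <=
  \sum_(0 <= i < n) (`|G (p i.+1)| + K * (p i.+1 - p i)) * (V (p i.+1) - V (p i)).
Proof.
move=> ui dG cg gK uV p0.
(* Induction on the number of intervals with the right end point free: the last interval is split
   off, and the boundary terms at [p n] cancel. *)
elim: n b ui dG cg gK uV => [|n IH] b ui dG cg gK uV pn pi.
  by rewrite -pn p0 set_itv1 Rintegral_set1 big_nil sub0r addNr normr0.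
have ple i : (i <= n)%N -> a <= p i.
  elim: i => [|i ih] ilen; first by rewrite p0.
  by apply: le_trans (ih (ltnW ilen)) (pi _ _); rewrite ltnS ltnW.
have an := ple n (leqnn n).
have nb : p n <= b by rewrite -pn pi.
have sub1 t : a <= t <= p n -> a <= t <= b.
  by move=> /andP[-> tn]; rewrite (le_trans tn nb).
have sub2 t : p n <= t <= b -> a <= t <= b.
  by move=> /andP[nt ->]; rewrite (le_trans an nt).
have ug := integrable_mul_continuous ui cg.
rewrite big_nat_recr//= (Rintegral_itv_cat an nb ug).
set I1 := Rintegral _ _ _; set I2 := Rintegral _ _ _.
have -> : I1 + I2 - u b * G b + u a * G a =
  (I1 - u (p n) * G (p n) + u a * G a) + (I2 - u b * G b + u (p n) * G (p n)) by ring.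
apply: (le_trans (ler_normD _ _)); apply: lerD.
  apply: IH => //.
  - exact: integrable_itvS ui.
  - by move=> t /sub1; exact: dG.
  - by move=> t /sub1; exact: cg.
  - by move=> t /sub1; exact: gK.
  - by move=> x y ax xy yn; apply: uV => //; exact: le_trans nb.
  - by move=> i ilen; apply: pi; rewrite ltnW.
rewrite pn; apply: by_parts_step => //.
- exact: integrable_itvS ui.
- by move=> t /sub2; exact: dG.
- by move=> t /sub2; exact: cg.
- by move=> t /sub2; exact: gK.
- move=> t /andP[nt tb].
  have h1 := uV _ _ an nt tb; have h2 := uV _ _ (le_trans an nt) tb (lexx b).
  apply: (le_trans h1); rewrite lerD2r.
  by rewrite -subr_ge0 (le_trans _ h2).
Qed.

Lemma fine_itv_partition a b (d : R) : a <= b -> 0 < d ->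
  exists2 s, itv_partition a b s &
    forall n, (n < size s)%N -> nth a (a :: s) n.+1 - nth a (a :: s) n < d.
Proof.
move=> ab d0.
(* Steps of length d / 2 keep the mesh strictly below d; the induction is on a number of such steps
   that covers [a, b]. *)
have h0 : 0 < d / 2 by rewrite divr_gt0.
have [n bn] : exists n, b - a <= n%:R * (d / 2).
  exists (Num.bound ((b - a) / (d / 2))).
  rewrite -ler_pdivrMr//; apply/ltW/archi_boundP.
  by rewrite divr_ge0 ?subr_ge0// ltW.
elim: n a ab bn => [|n IH] a ab bn.
  exists [::] => //; rewrite mul0r subr_le0 in bn.
  by split => //=; rewrite eq_le ab bn.
have [bad|bad] := lerP (b - a) (d / 2).
  (* Partitions are strictly increasing, so a degenerate interval gets the empty one. *)
  move: ab; rewrite le_eqVlt => /predU1P[<-|ab].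
    by exists [::] => //; split => //=.
  exists [:: b]; first exact: itv_partition1.
  by case=> [|//] _ /=; apply: le_lt_trans bad _; lra.
have [|| s sp sd] := IH (a + d / 2).
- by lra.
- by rewrite -natr1 in bn; lra.
exists (a + d / 2 :: s).
  case: sp => sp /= e; split => //=.
  by rewrite sp andbT ltrDl.
move=> [|m] /= ms; first by lra.
have := sd m ms; rewrite /=.
by rewrite !(set_nth_default a (a + d / 2))//= ?ltnS// ltnW.
Qed.

Lemma itv_partition_nth_lt a b s i : itv_partition a b s -> (i < size s)%N ->
  nth a (a :: s) i < nth a (a :: s) i.+1.
Proof. by move=> [/(pathP a) h _] /h. Qed.

Lemma itv_partition_nth_itv a b s i : itv_partition a b s -> (i <= size s)%N ->
  a <= nth a (a :: s) i <= b.
Proof.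
move=> sp ilen; rewrite (set_nth_default b)//=.
by rewrite (itv_partition_nth_ge _ sp) ?(itv_partition_nth_le _ sp).
Qed.

(** Since |G| <= D w, the sum in [by_parts_sum] is at most D times a Stieltjes sum of [w] tagged at
    right end points, plus K times the mesh times V b - V a. Refining the partition leaves D * J up
    to an arbitrary error. *)
Lemma by_parts_stieltjes u g G w V a b (J D : R) : a <= b -> 0 <= D ->
  mu.-integrable `[a, b] (EFin \o u) ->
  (forall t, a <= t <= b -> is_derive t 1 G (g t)) ->
  (forall t, a <= t <= b -> {for t, continuous g}) ->
  (forall t, a <= t <= b -> `|G t| <= D * w t) ->
  (forall x y, a <= x -> x <= y -> y <= b -> `|u y - u x| <= V y - V x) ->
  is_stieltjes w V a b J ->
  `|\int[mu]_(t in `[a, b]) (u t * g t) - u b * G b + u a * G a| <= D * J.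
Proof.
move=> ab D0 ui dG cg Gw uV st.
have [|c _ cmax] := @EVT_max R (fun t => `|g t|) a b ab.
  apply: within_continuous_itv => t tab; apply: continuous_comp; first exact: cg.
  exact: norm_continuous.
set K := `|g c| in cmax.
have gK t : a <= t <= b -> `|g t| <= K.
  by move=> tab; apply: cmax; rewrite in_itv.
have K0 : 0 <= K by exact: normr_ge0.
have V0 : 0 <= V b - V a by apply: le_trans (uV a b _ _ _).
apply/ler_addgt0Pr => e e0.
(* The errors D e' and K e' (V b - V a) then add up to less than e; the extra 1 keeps the
   denominator positive. *)
pose e' := e / (D + K * (V b - V a) + 1).
have den : 0 < D + K * (V b - V a) + 1 by rewrite ltr_wpDl// addr_ge0// mulr_ge0.
have e'0 : 0 < e' by rewrite divr_gt0.
have [d d0 std] := st _ e'0.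
(* The mesh has to be below [d] for the Stieltjes sum and below [e'] for the term with [K]. *)
have de0 : 0 < Num.min d e' by rewrite lt_min d0.
have [s sp sd] := fine_itv_partition ab de0.
set p := nth a (a :: s) in sd.
have pn : p (size s) = b by exact: itv_partition_nth_size.
have plt i : (i < size s)%N -> p i <= p i.+1.
  by move=> /(itv_partition_nth_lt sp)/ltW.
have /= := by_parts_sum ui dG cg gK uV (erefl : p 0%N = a) pn plt.
move/le_trans; apply.
set S := stieltjes_sum w V a s (fun i => p i.+1).
have SJ : S <= J + e'.
  rewrite addrC -lerBlDr; apply/ltW.
  apply: le_lt_trans (ler_norm _) (std s _ sp _) => i si /=.
  split; [exact: plt|exact: lexx|].
  by apply: (lt_le_trans (sd i si)); rewrite ge_min lexx.
apply: (@le_trans _ _ (D * S + K * e' * (V b - V a))).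
  rewrite /S /stieltjes_sum -/p -pn.
  have -> : V a = V (p 0%N) by [].
  rewrite -(@telescope_sumr _ 0 (size s) (fun i => V (p i)))// !mulr_sumr.
  rewrite -big_split/= !big_nat; apply: ler_sum => i /andP[_ si].
  have /andP[ai ib] := itv_partition_nth_itv sp (ltnW si).
  have /andP[aj jb] := itv_partition_nth_itv sp si.
  have dV : 0 <= V (p i.+1) - V (p i).
    by apply: le_trans (uV (p i) (p i.+1) ai (plt i si) jb).
  rewrite mulrA -mulrDl ler_wpM2r// lerD//; first by apply: Gw; rewrite aj jb.
  rewrite ler_wpM2l// (le_trans (ltW (sd i si)))// ge_min lexx orbT//.
apply: (@le_trans _ _ (D * (J + e') + K * e' * (V b - V a))).
  by rewrite lerD2r ler_wpM2l.
have : e' * (D + K * (V b - V a) + 1) = e by rewrite divfK// gt_eqF.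
move=> <-.
have -> : D * J + e' * (D + K * (V b - V a) + 1) =
  D * (J + e') + K * e' * (V b - V a) + e' by ring.
by rewrite lerDl ltW.
Qed.

(** A partition of [a, b] continued by one of [b, c] only adds nonnegative terms to the Stieltjes
    sum. *)
Lemma stieltjes_le w V a b c (J J' : R) : a <= b -> b <= c ->
  (forall t, a <= t <= c -> 0 <= w t) ->
  (forall x y, a <= x -> x <= y -> y <= c -> V x <= V y) ->
  is_stieltjes w V a b J -> is_stieltjes w V a c J' -> J <= J'.
Proof.
move=> ab bc w0 Vm stb stc.
apply/ler_addgt0Pr => e e0.
have e20 : 0 < e / 2 by rewrite divr_gt0.
have [d d0 std] := stb _ e20; have [d' d'0 std'] := stc _ e20.
have dd0 : 0 < Num.min d d' by rewrite lt_min d0.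
have [s sp sd] := fine_itv_partition ab dd0.
have [s' sp' sd'] := fine_itv_partition bc dd0.
have sp2 := itv_partition_cat sp sp'.
pose p := nth a (a :: s ++ s').
(* The shared point b has index [size s]: it is the last point of [s] and the base point of [s']. *)
have pE i : (i <= size s)%N -> nth a (a :: s) i = p i.
  by move=> ilen; rewrite /p -cat_cons nth_cat/= ltnS ilen.
have pE' i : (i <= size s')%N -> p (size s + i)%N = nth b (b :: s') i.
  case: i => [_|i si]; first by rewrite addn0 -pE// (itv_partition_nth_size _ sp).
  rewrite addnS /p/= nth_cat ltnNge leq_addr/= addKn.
  exact: set_nth_default.
have pd i : (i < size (s ++ s'))%N -> p i.+1 - p i < Num.min d d'.
  rewrite size_cat => ilt; have [si|si] := ltnP i (size s).
    by rewrite -!pE ?(ltnW si)//; exact: sd.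
  have isub : (i - size s < size s')%N by rewrite ltn_subLR.
  rewrite -(subnKC si) -addnS !pE' ?(ltnW isub)//; exact: sd'.
have pm i : (i < size (s ++ s'))%N -> p i <= p i.+1.
  by move=> /(itv_partition_nth_lt sp2)/ltW.
set S := stieltjes_sum w V a s (fun i => p i.+1).
set S' := stieltjes_sum w V a (s ++ s') (fun i => p i.+1).
have JS : J <= S + e / 2.
  rewrite -lerBlDl; apply/ltW.
  apply: le_lt_trans (ler_norm _) _; rewrite distrC; apply: std => // i si.
  have si' : (i < size (s ++ s'))%N by rewrite size_cat ltn_addr.
  cbv zeta; rewrite !pE ?(ltnW si)//; split; [exact: pm|exact: lexx|].
  by apply: (lt_le_trans (pd i si')); rewrite ge_min lexx.
have JS' : S' <= J' + e / 2.
  rewrite -lerBlDl; apply/ltW.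
  apply: le_lt_trans (ler_norm _) (std' _ _ sp2 _) => i si; rewrite -/p.
  split; [exact: pm|exact: lexx|].
  by apply: (lt_le_trans (pd i si)); rewrite ge_min lexx orbT.
have SS : S <= S'.
  rewrite /S /S' /stieltjes_sum -/p.
  rewrite [leRHS](@big_cat_nat _ _ _ (size s))//; last by rewrite size_cat leq_addr.
  rewrite -[leLHS]addr0 lerD//.
    rewrite le_eqVlt; apply/orP; left; apply/eqP.
    by apply: eq_big_nat => i /andP[_ si]; rewrite !pE ?(ltnW si)//.
  rewrite big_nat; apply: sumr_ge0 => i /andP[_ si].
  have /andP[ai ib] := itv_partition_nth_itv sp2 (ltnW si).
  have /andP[aj jb] := itv_partition_nth_itv sp2 si.
  by rewrite mulr_ge0 ?w0 ?aj ?jb// subr_ge0 Vm// pm.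
lra.
Qed.

End integration_by_parts_bv.

(** * Bounds for the tail integrals, uniform in the frequency r *)

Section oscillatory_tail.
Context {R : realType}.
Variables (alpha nu : R).
Hypothesis halpha : - (1 / 2) <= alpha.
Implicit Types (a b r t x y M N e : R) (u V : R -> R).

Local Notation mu := (@lebesgue_measure R).

Let powRDE t x y : 0 < t -> t `^ x * t `^ y = t `^ (x + y).
Proof. by move=> t0; rewrite powRD// (gt_eqF t0) implybT. Qed.

Let powRS t x : 0 < t -> t `^ (x + 1) = t * t `^ x.
Proof. by move=> t0; rewrite -powRDE// powRr1 ?ltW// mulrC. Qed.

Lemma is_derive_scaled (F : R -> R) (c x d : R) :
  is_derive (c * x) 1 F d -> is_derive x 1 (fun t => F (c * t)) (c * d).
Proof.
move=> dF; have dc : is_derive x 1 (fun t => c * t) (c * 1).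
  exact: is_derive1Ml (is_derive_id x 1).
by apply: (is_derive1_eq (is_derive1_chain dF dc)); rewrite mulr1 mulrC.
Qed.

Lemma continuous_powR_scaled (F : R -> R) (c s x : R) : 0 < x ->
  {for c * x, continuous F} ->
  {for x, continuous (fun t => t `^ s * F (c * t))}.
Proof.
move=> x0 cF; apply: continuousM.
  exact: is_derive_continuous (is_derive1_powR s x0).
apply: (@continuous_comp _ _ _ ( *%R c) F) => //.
exact: mulrl_continuous.
Qed.

Lemma transform_kernel_primitive r t : 0 < r -> 0 < t ->
  is_derive t 1 (fun t => - r^-1 * (t `^ nu * bessel_series' alpha (r * t)))
    (t `^ nu * bessel_series alpha (r * t) -
     (nu - 2 * alpha - 1) / r * (t `^ (nu - 1) * bessel_series' alpha (r * t))).
Proof.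
move=> r0 t0; have rt0 : 0 < r * t by rewrite mulr_gt0.
have d1 := is_derive_scaled (is_derive_bessel_series' halpha (r * t)).
apply: (is_derive1_eq (is_derive1Ml _ (is_derive1M (is_derive1_powR nu t0) d1))).
(* Bessel's equation eliminates j''; its term with -(2 alpha + 1) and the nu from differentiating
   t^nu combine into nu - 2 alpha - 1. *)
have -> : bessel_series'' alpha (r * t) =
    - ((2 * alpha + 1) * bessel_series' alpha (r * t) / (r * t)
       + bessel_series alpha (r * t)).
  have z0 : r * t != 0 by rewrite gt_eqF.
  by apply: (mulfI z0); rewrite bessel_series_ode//; field; rewrite !gt_eqF.
have -> : t `^ nu = t * t `^ (nu - 1) by rewrite -powRS// subrK.
by field; rewrite !gt_eqF.
Qed.

Lemma small_frequency_bound : exists2 C : R, 0 <= C &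
  forall u r M N e, 0 <= r -> 0 < M -> M <= N -> r * N <= 1 -> 0 <= e ->
  mu.-integrable `[M, N] (EFin \o u) ->
  (forall t, M <= t <= N -> `|u t| <= e * t `^ (- nu - 1)) ->
  `|\int[mu]_(t in `[M, N]) (u t * t `^ nu)| <= e ->
  `|\int[mu]_(t in `[M, N]) (u t * (t `^ nu * bessel_series alpha (r * t)))| <= C * e.
Proof.
have [C C0 hC] := bessel_series_near0 halpha.
(* The 1 is for the main term, with kernel t^nu; [C] is for the error from j - 1. *)
exists (1 + C); first by rewrite addr_ge0.
move=> u r M N e r0 M0 MN rN e0 ui ue ie.
have pos t : M <= t <= N -> 0 < t by move=> /andP[Mt _]; apply: lt_le_trans Mt.
have ck s t : M <= t <= N ->
    {for t, continuous (fun t => t `^ s * bessel_series alpha (r * t))}.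
  move=> /pos t0; apply: continuous_powR_scaled => //.
  exact: continuous_bessel_series.
have cp t : M <= t <= N -> {for t, continuous (fun t => t `^ nu)}.
  by move=> /pos t0; exact: is_derive_continuous (is_derive1_powR nu t0).
have i1 := integrable_mul_continuous ui cp.
have i2 := integrable_mul_continuous ui (ck nu).
have := RintegralB _ i2 i1 => /(_ (measurable_itv _)).
set I2 := \int[mu]_(t in _) (u t * (t `^ nu * _)).
set I1 := \int[mu]_(t in _) (u t * _) => E.
have -> : I2 = (I2 - I1) + I1 by rewrite subrK.
rewrite (le_trans (ler_normD _ _))// mulrDl mul1r addrC lerD//.
(* The powers of t cancel, t^(-nu-1) t^nu t = 1, so the error integrand is bounded by a constant;
   then r (N - M) <= r N <= 1. *)
rewrite -E; apply: le_trans (norm_Rintegral_le_cst (M := C * e * r) MN _ _) _.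
- exact: integrable_EFinB.
- move=> t tMN; have t0 := pos t tMN; have /andP[Mt tN] := tMN.
  have -> : u t * (t `^ nu * bessel_series alpha (r * t)) - u t * t `^ nu =
    u t * t `^ nu * (bessel_series alpha (r * t) - 1) by ring.
  rewrite !normrM (ger0_norm (powR_ge0 _ _)).
  apply: (@le_trans _ _ (e * t `^ (- nu - 1) * t `^ nu * (C * (r * t)))).
    apply: ler_pM => //; rewrite ?mulr_ge0 ?powR_ge0//.
      by rewrite ler_wpM2r ?powR_ge0// ue.
    apply: hC; rewrite mulr_ge0 ?(ltW t0)//=.
    by rewrite (le_trans _ rN)// ler_wpM2l.
  have p1 : t `^ (- nu - 1) * t `^ nu * t = 1.
    rewrite powRDE// (_ : - nu - 1 + nu = - 1); last by ring.
    by rewrite powR_inv1 ?ltW// mulVf// gt_eqF.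
  have -> : e * t `^ (- nu - 1) * t `^ nu * (C * (r * t)) =
    C * e * r * (t `^ (- nu - 1) * t `^ nu * t) by ring.
  by rewrite p1 mulr1.
- rewrite -mulrA ler_piMr ?mulr_ge0// (le_trans _ rN)// ler_wpM2l//.
  by rewrite gerBl ltW.
Qed.


Lemma large_frequency_bound : exists2 C : R, 0 <= C &
  forall u V r a b e J, 0 < r -> 0 < a -> a <= b -> 1 <= r * a -> 0 <= e ->
  mu.-integrable `[a, b] (EFin \o u) ->
  (forall t, a <= t <= b -> `|u t| <= e * t `^ (- nu - 1)) ->
  (forall x y, a <= x -> x <= y -> y <= b -> `|u y - u x| <= V y - V x) ->
  is_stieltjes (fun t => t `^ (nu - alpha - 1 / 2)) V a b J ->
  J <= e * a `^ (- alpha - 3 / 2) ->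
  `|\int[mu]_(t in `[a, b]) (u t * (t `^ nu * bessel_series alpha (r * t)))| <= C * e.
Proof.
have [C C0 hC] := bessel_series'_decay halpha.
pose c := nu - 2 * alpha - 1.
(* One [C] for the Stieltjes term and for each of the two boundary terms, and |c| C for the
   absolutely integrable remainder. *)
exists (3 * C + `|c| * C); first by rewrite addr_ge0 ?mulr_ge0.
move=> u V r a b e J r0 a0 ab ra e0 ui ue uV st Je.
have pos t : a <= t <= b -> 0 < t by move=> /andP[at' _]; apply: lt_le_trans at'.
have ck s F t : (forall z, {for z, continuous F}) -> a <= t <= b ->
    {for t, continuous (fun t => t `^ s * F (r * t))}.
  by move=> cF /pos t0; exact: continuous_powR_scaled.
pose G t := - r^-1 * (t `^ nu * bessel_series' alpha (r * t)).
pose h t := t `^ (nu - 1) * bessel_series' alpha (r * t).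
pose g t := t `^ nu * bessel_series alpha (r * t) - c / r * h t.
have dG t : a <= t <= b -> is_derive t 1 G (g t).
  by move=> /pos t0; exact: transform_kernel_primitive.
have ch t : a <= t <= b -> {for t, continuous h}.
  by apply: ck => z; exact: continuous_bessel_series'.
have cB t : a <= t <= b ->
    {for t, continuous (fun t => t `^ nu * bessel_series alpha (r * t))}.
  by apply: ck => z; exact: continuous_bessel_series.
have cg t : a <= t <= b -> {for t, continuous g}.
  move=> tab; apply: continuousB; first exact: cB.
  by apply: continuousM; [exact: cvg_cst|exact: ch].
pose be := alpha + 3 / 2.
have be1 : 1 <= be by rewrite /be; have := halpha; lra.
(* The factor 1 / r of the primitive and the decay (r t)^(-alpha-1/2) of j' combine to r^(-be). *)
pose D := C * r `^ (- be).
have D0 : 0 <= D by rewrite mulr_ge0 ?powR_ge0.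
have decay t : a <= t <= b ->
    `|bessel_series' alpha (r * t)| / r <= D * t `^ (- (alpha + 1 / 2)).
  move=> /[dup] /pos t0 /andP[at' _].
  have rt1 : 1 <= r * t by rewrite (le_trans ra)// ler_wpM2l// ltW.
  apply: (@le_trans _ _ (C * (r * t) `^ (- (alpha + 1 / 2)) / r)).
    by rewrite ler_wpM2r ?invr_ge0 ?(ltW r0)// hC.
  rewrite (powRM _ (ltW r0) (ltW t0)) /D.
  rewrite (_ : - (alpha + 1 / 2) = - be + 1); last by rewrite /be; field.
  rewrite (powRS _ r0) le_eqVlt; apply/orP; left; apply/eqP.
  by field; rewrite gt_eqF.
have GD t : a <= t <= b -> `|G t| <= D * t `^ (nu - alpha - 1 / 2).
  move=> tab; have t0 := pos t tab.
  rewrite (_ : nu - alpha - 1 / 2 = nu + - (alpha + 1 / 2)); last by ring.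
  have -> : `|G t| = t `^ nu * (`|bessel_series' alpha (r * t)| / r).
    rewrite /G !normrM normrN normfV (gtr0_norm r0) (ger0_norm (powR_ge0 _ _)).
    by ring.
  by rewrite -powRDE// [leRHS]mulrCA ler_wpM2l ?powR_ge0// decay.
(* The left-hand side is C (r a)^(-be) with r a >= 1. All four final bounds pass through this
   inequality. *)
have Da : D * a `^ (- be) <= C.
  rewrite /D -mulrA -(powRM _ (ltW r0) (ltW a0)) ler_piMr// -(powRr0 (r * a)) ler_powR//.
  by rewrite oppr_le0 (le_trans ler01).
have Dmono t : a <= t -> t `^ (- be) <= a `^ (- be).
  move=> at'; have t0 : 0 < t := lt_le_trans a0 at'.
  rewrite !powRN lef_pV2 ?posrE ?powR_gt0//.
  apply: ge0_ler_powR; rewrite ?nnegrE ?(ltW a0) ?(ltW t0)//.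
  exact: le_trans be1.
have uG t : a <= t <= b -> `|u t * G t| <= C * e.
  move=> tab; have t0 := pos t tab; have /andP[at' _] := tab.
  rewrite normrM; apply: le_trans (ler_pM _ _ (ue t tab) (GD t tab)) _ => //.
  have -> : e * t `^ (- nu - 1) * (D * t `^ (nu - alpha - 1 / 2)) =
      e * (D * (t `^ (- nu - 1) * t `^ (nu - alpha - 1 / 2))) by ring.
  rewrite powRDE// (_ : - nu - 1 + (nu - alpha - 1 / 2) = - be); last first.
    by rewrite /be; field.
  rewrite mulrC ler_wpM2r// (le_trans _ Da)// ler_wpM2l//; exact: Dmono.
have bp := by_parts_stieltjes ab D0 ui dG cg GD uV st.
have igu := integrable_mul_continuous ui cg.
have ihu := integrable_mul_continuous ui ch.
have ihu' : mu.-integrable `[a, b] (EFin \o (fun t => c / r * (u t * h t))).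
  exact: integrable_EFinZl.
have -> : \int[mu]_(t in `[a, b]) (u t * (t `^ nu * bessel_series alpha (r * t))) =
    \int[mu]_(t in `[a, b]) (u t * g t) + \int[mu]_(t in `[a, b]) (c / r * (u t * h t)).
  rewrite -RintegralD//; apply: eq_Rintegral => t _.
  by rewrite /g; ring.
apply: (le_trans (ler_normD _ _)); rewrite [leRHS]mulrDl lerD//.
  set I := \int[mu]_(_ in _) _ in bp *.
  have -> : I = (I - u b * G b + u a * G a) + u b * G b - u a * G a by ring.
  apply: (le_trans (ler_normB _ _)).
  have -> : 3 * C * e = C * e + C * e + C * e by ring.
  apply: lerD; last by apply: uG; rewrite lexx.
  apply: (le_trans (ler_normD _ _)).
  apply: lerD; last by apply: uG; rewrite lexx andbT.
  apply: (le_trans bp); apply: (le_trans (ler_wpM2l D0 Je)).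
  rewrite mulrCA mulrC ler_wpM2r//.
  by rewrite (_ : - alpha - 3 / 2 = - be)//; rewrite /be; ring.
(* The remainder is dominated by a multiple of t^(-be-1), whose integral is at most a^(-be) / be <=
   a^(-be), as be >= 1. *)
have dP t : a <= t <= b ->
    is_derive t 1 (fun t => - be^-1 * t `^ (- be)) (t `^ (- be - 1)).
  move=> /pos t0; apply: (is_derive1_eq (is_derive1Ml _ (is_derive1_powR (- be) t0))).
  by field; rewrite gt_eqF// (lt_le_trans _ be1).
have cP t : a <= t <= b -> {for t, continuous (fun t => t `^ (- be - 1))}.
  by move=> /pos t0; exact: is_derive_continuous (is_derive1_powR _ t0).
have iP := continuous_itv_integrable cP.
have iP' : mu.-integrable `[a, b]
    (EFin \o (fun t => `|c| * e * D * t `^ (- be - 1))).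
  exact: integrable_EFinZl.
apply: le_trans (le_norm_Rintegral ihu' iP' _) _.
  move=> t tab; have t0 := pos t tab.
  rewrite /h; have := decay t tab.
  move: (bessel_series' alpha (r * t)) => q dec.
  rewrite !normrM (ger0_norm (powR_ge0 _ _)) normfV (gtr0_norm r0).
  have -> : `|c| / r * (`|u t| * (t `^ (nu - 1) * `|q|)) =
    `|c| * (`|u t| * (t `^ (nu - 1) * (`|q| / r))) by ring.
  have -> : t `^ (- be - 1) =
      t `^ (- nu - 1) * (t `^ (nu - 1) * t `^ (- (alpha + 1 / 2))).
    by rewrite !powRDE//; congr (_ `^ _); rewrite /be; field.
  have -> : `|c| * e * D *
      (t `^ (- nu - 1) * (t `^ (nu - 1) * t `^ (- (alpha + 1 / 2)))) =
    `|c| * (e * t `^ (- nu - 1) * (t `^ (nu - 1) * (D * t `^ (- (alpha + 1 / 2))))).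
    by ring.
  rewrite ler_wpM2l//.
  apply: ler_pM; rewrite ?ue ?mulr_ge0 ?powR_ge0 ?invr_ge0 ?(ltW r0)//.
  by rewrite ler_wpM2l ?powR_ge0.
rewrite RintegralZl// (Rintegral_is_derive ab dP cP).
have -> : `|c| * C * e = `|c| * e * C by ring.
rewrite -(mulrA (`|c| * e)) ler_wpM2l ?mulr_ge0//.
apply: le_trans Da; rewrite ler_wpM2l//.
apply: (@le_trans _ _ (be^-1 * a `^ (- be))).
  rewrite mulNr mulNr opprK addrC gerBl mulr_ge0 ?powR_ge0// invr_ge0.
  exact: le_trans be1.
by rewrite ler_piMl ?powR_ge0// invf_le1// (lt_le_trans _ be1).
Qed.

(** The split at t = 1 / r. Either regime may cover all of [M, N], and r = 0 falls under the first.
    [C] is chosen before [u], [r] and the interval, which makes the estimate uniform. *)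
Lemma tail_bound : exists2 C : R, 0 <= C &
  forall u M0 e, 0 < M0 -> 0 <= e ->
  (forall a b, M0 <= a -> mu.-integrable `[a, b] (EFin \o u)) ->
  (forall t, M0 <= t -> `|u t| <= e * t `^ (- nu - 1)) ->
  (forall a b, M0 <= a -> a <= b ->
     `|\int[mu]_(t in `[a, b]) (u t * t `^ nu)| <= e) ->
  (forall a b, M0 <= a -> a <= b -> exists V J,
    [/\ forall x y, a <= x -> x <= y -> y <= b -> `|u y - u x| <= V y - V x,
       is_stieltjes (fun t => t `^ (nu - alpha - 1 / 2)) V a b J &
       J <= e * a `^ (- alpha - 3 / 2)]) ->
  forall r M N, 0 <= r -> M0 <= M -> M <= N ->
  `|\int[mu]_(t in `[M, N]) (u t * (t `^ nu * bessel_series alpha (r * t)))| <= C * e.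
Proof.
have [C1 C10 h1] := small_frequency_bound.
have [C2 C20 h2] := large_frequency_bound.
exists (C1 + C2); first by rewrite addr_ge0.
move=> u M0 e M00 e0 ui ue ie st r M N r0 M0M MN.
have small a b : M0 <= a -> a <= b -> r * b <= 1 ->
    `|\int[mu]_(t in `[a, b]) (u t * (t `^ nu * bessel_series alpha (r * t)))| <= C1 * e.
  move=> M0a ab rb; apply: h1 => //.
  - exact: lt_le_trans M0a.
  - exact: ui.
  - by move=> t /andP[at' _]; apply: ue; exact: le_trans at'.
  - exact: ie.
have large a b : M0 <= a -> a <= b -> 1 <= r * a ->
    `|\int[mu]_(t in `[a, b]) (u t * (t `^ nu * bessel_series alpha (r * t)))| <= C2 * e.
  move=> M0a ab ra; have a0 := lt_le_trans M00 M0a.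
  have r0' : 0 < r.
    by rewrite lt_neqAle r0 andbT; apply/eqP => r00; rewrite -r00 mul0r ler10 in ra.
  have [V [J [uV sJ Je]]] := st a b M0a ab.
  apply: (h2 u V r a b e J) => //.
  - exact: ui.
  - by move=> t /andP[at' _]; apply: ue; exact: le_trans at'.
have [rN|rN] := lerP (r * N) 1.
  by rewrite mulrDl (le_trans (small _ _ _ _ rN))// lerDl mulr_ge0.
have [rM|rM] := lerP 1 (r * M).
  by rewrite mulrDl (le_trans (large _ _ _ _ rM))// lerDr mulr_ge0.
have r0' : 0 < r.
  by rewrite lt_neqAle r0 andbT; apply/eqP => r00; rewrite -r00 mul0r ltr10 in rN.
have Mr : M <= r^-1 by rewrite -[leRHS]mul1r ler_pdivlMr// mulrC ltW.
have rN' : r^-1 <= N by rewrite -[leLHS]mul1r ler_pdivrMr// mulrC ltW.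
rewrite (Rintegral_itv_cat Mr rN'); last first.
  apply: integrable_mul_continuous; first exact: ui.
  move=> t /andP[Mt _]; apply: continuous_powR_scaled.
    by rewrite (lt_le_trans _ Mt)// (lt_le_trans M00).
  exact: continuous_bessel_series.
apply: (le_trans (ler_normD _ _)); rewrite [leRHS]mulrDl; apply: lerD.
  by apply: small => //; rewrite divff// gt_eqF.
by apply: large => //; rewrite ?divff ?gt_eqF// (le_trans M0M).
Qed.

End oscillatory_tail.

(** * Total variation as an integrator *)

Section variation_integral.
Context {R : realType}.
Implicit Types (a b x y : R) (f : R -> R[i]).

Lemma cvariations_neq0 a b f : a <= b -> cvariations a b f !=set0.
Proof.
move=> ab; have [s sp _] := fine_itv_partition ab (@ltr01 R).
by exists (cvariation a b f s); exists s.
Qed.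

Lemma fine_ctotal_variation a b f : a <= b -> cbounded_variation a b f ->
  fine (ctotal_variation a b f) = sup (cvariations a b f).
Proof.
by move=> ab bv; rewrite /ctotal_variation ereal_sup_EFin//; exact: cvariations_neq0.
Qed.

Lemma ctotal_variation_increment f a x y : clocally_bounded_variation f ->
  0 < a -> a <= x -> x <= y ->
  cmod (f y - f x) <=
  fine (ctotal_variation a y f) - fine (ctotal_variation a x f).
Proof.
move=> bv a0 ax; rewrite le_eqVlt => /predU1P[<-|xy].
  by rewrite !subrr ComplexField.Normc.normc0.
have ay : a <= y by rewrite (le_trans ax)// ltW.
rewrite !fine_ctotal_variation//; [|exact: bv..].
rewrite lerBrDl -lerBrDr; apply: ge_sup; first exact: cvariations_neq0.
move=> _ [s sp <-]; rewrite lerBrDr.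
apply: ub_le_sup; first exact: bv.
exists (rcons s y).
  case: sp => sp /eqP e; split; last by rewrite last_rcons.
  by rewrite rcons_path sp/= e.
(* [cvariation] takes its right end point as the default of [nth], so the two sums carry the
   defaults y and x; on indices in range they agree. *)
rewrite /cvariation size_rcons big_nat_recr//=; congr (_ + _).
  apply: eq_big_nat => i /andP[_ si].
  rewrite -!rcons_cons !nth_rcons/= ltnS si (ltnW si) /=.
  by rewrite (set_nth_default x)// (@set_nth_default _ (a :: s) x y)//= ltnS ltnW.
rewrite -rcons_cons !nth_rcons ltnn eqxx/= ltnSn.
have -> : nth y (a :: s) (size s) = x.
  by rewrite (set_nth_default x)//=; exact: itv_partition_nth_size.
by [].
Qed.

(** [V] is the total variation counted from a and [J] its integral of w up to b. As w >= 0 and [V]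
    is nondecreasing, partial integrals grow with the upper limit and stay below their limit [I]. *)
Lemma variation_integral_restrict (w : R -> R) f a b I :
  clocally_bounded_variation f -> 0 < a -> a <= b ->
  (forall t : R, 0 < t -> 0 <= w t) -> is_variation_integral w f a I ->
  exists V J, [/\ forall x y, a <= x -> x <= y -> y <= b ->
                    cmod (f y - f x) <= V y - V x,
                 is_stieltjes w V a b J & J <= I].
Proof.
move=> bv a0 ab w0 [J sJ Jl].
pose V t := fine (ctotal_variation a t f).
have fV x y : a <= x -> x <= y -> cmod (f y - f x) <= V y - V x.
  exact: ctotal_variation_increment.
exists V, (J b); split; [by move=> x y ax xy _; exact: fV|exact: sJ|].
apply: (cvgr_to_ge Jl); near=> c.
have bc : b <= c by near: c; apply: nbhs_pinfty_ge; exact: num_real.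
apply: (@stieltjes_le _ w V a b c) => //; first 1 last.
- move=> x y ax xy yc; rewrite -subr_ge0; apply: le_trans (fV x y ax xy).
  by case: (f y - f x) => p q; exact: sqrtr_ge0.
- exact: sJ.
- exact/sJ/(le_trans ab).
- by move=> t /andP[at' _]; apply: w0; exact: lt_le_trans at'.
Unshelve. all: by end_near. Qed.

End variation_integral.

(** * The uniform Cauchy criterion *)

Section uniform_limit.
Context {R : realType}.

(** Pointwise limits exist by completeness; letting the larger index tend to infinity in the Cauchy
    estimate keeps the threshold independent of r. *)
Lemma uniform_cauchy_limit (T : R -> R -> R) (E : set R) :
  (forall e : R, 0 < e -> exists K : R, forall M N r, E r -> K <= M -> M <= N ->
     `|T N r - T M r| <= e) ->
  exists l : R -> R, forall e : R, 0 < e -> exists K : R, forall N r, E r ->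
    K <= N -> `|T N r - l r| <= e.
Proof.
move=> cT.
have cvT r : E r -> cvg (T N r @[N --> +oo]).
  move=> Er; apply/cauchy_cvgP/cauchy_exP => _/posnumP[e].
  have [|K hK] := cT (e%:num / 2); first by [].
  exists (T K r); rewrite /= nbhs_simpl; near=> N => /=.
  rewrite /ball/= distrC; apply: (@le_lt_trans _ _ (e%:num / 2)).
    by apply: hK => //; near: N; apply: nbhs_pinfty_ge; exact: num_real.
  by rewrite ltr_pdivrMr// ltr_pMr// ltr1n.
exists (fun r => lim (T N r @[N --> +oo])) => e e0.
have [K hK] := cT e e0; exists K => M r Er KM.
have := cvT r Er; move: (lim _) => l Tl.
rewrite distrC.
have Tl' : `|T N r - T M r| @[N --> +oo] --> `|l - T M r|.
  by apply: cvg_norm; apply: cvgB => //; exact: cvg_cst.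
apply: (cvgr_to_le Tl'); near=> N; exact: hK.
Unshelve. all: by end_near. Qed.

End uniform_limit.

(** * Uniform convergence for one real component *)

Section real_transform.
Context {R : realType}.
Variables (alpha nu : R).
Hypothesis halpha : - (1 / 2) <= alpha.
Variable u : R -> R.

Local Notation mu := (@lebesgue_measure R).

Hypothesis u_loc : locally_integrable `]0, +oo[ u.
Hypothesis u_near0 : mu.-integrable `]0, 1[ (EFin \o (fun t => u t * t `^ nu)).

Lemma locally_integrable_itv a b : 0 < a -> mu.-integrable `[a, b] (EFin \o u).
Proof.
move=> a0; case: u_loc => mu_u ou iu.
have sub : (`[a, b]%classic : set R) `<=` `]0, +oo[%classic.
  by move=> t /=; rewrite !in_itv/= andbT => /andP[at' _]; exact: lt_le_trans at'.
apply/integrableP; split.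
  by apply/measurable_EFinP; apply: measurable_funS mu_u.
by apply: iu => //; exact: segment_compact.
Qed.

Lemma continuous_powR_itv a b (s t : R) : 0 < a -> a <= t <= b ->
  {for t, continuous (fun t => t `^ s)}.
Proof.
move=> a0 /andP[at' _].
exact: is_derive_continuous (is_derive1_powR s (lt_le_trans a0 at')).
Qed.

(** The hypothesis on ]0, 1[ is joined to local integrability times a continuous power on [1, N];
    the end point 0 is left out, as both hypotheses live on the open half-line. *)
Lemma integrable_weight N : mu.-integrable `]0, N] (EFin \o (fun t => u t * t `^ nu)).
Proof.
have i1N : mu.-integrable `[1, N] (EFin \o (fun t => u t * t `^ nu)).
  apply: integrable_mul_continuous; first exact: locally_integrable_itv.
  by move=> t; exact: continuous_powR_itv.
have : mu.-integrable (`]0, 1[ `|` `[1, N]) (EFin \o (fun t => u t * t `^ nu)).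
  apply: integrable_setU_disjoint => //.
  rewrite disj_set2E; apply/eqP/seteqP; split => // t /=.
  rewrite !in_itv/= => -[/andP[_ t1] /andP[t1' _]].
  by rewrite ltNge t1' in t1.
apply: integrableS => //; first exact: measurableU.
move=> t /=; rewrite !in_itv/= => /andP[t0 tN].
by have [t1|t1] := ltP t 1; [left; rewrite t0|right; rewrite tN].
Qed.

Lemma integrable_transform N r : mu.-integrable `]0, N]
  (EFin \o (fun t => u t * (t `^ nu * bessel_series alpha (r * t)))).
Proof.
have cB : continuous (fun t => bessel_series alpha (r * t)).
  move=> t; apply: (@continuous_comp _ _ _ ( *%R r) (bessel_series alpha)).
    exact: mulrl_continuous.
  exact: continuous_bessel_series.
rewrite (_ : _ \o _ = (EFin \o (fun t => u t * t `^ nu)%R) \*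
    (EFin \o (fun t => bessel_series alpha (r * t))%R))%E; last first.
  by apply/funext => t /=; rewrite mulrA.
apply: integrableMl => //.
- exact: integrable_weight.
- by apply: measurable_funTS; exact: continuous_measurable_fun.
- have /compact_bounded[M [Mr HM]] := continuous_compact
    (continuous_subspaceT cB) (@segment_compact R 0 N).
  exists M; split => // x /HM Hx t /=; rewrite in_itv/= => /andP[t0 tN].
  by apply: Hx; exists t => //=; rewrite in_itv/= (ltW t0).
Qed.

(** One component of [transform_partial] for mu = - nu, where the prefactor is 1, with the entire
    function in place of [bessel_j]. *)
Definition real_transform_partial N r : R :=
  \int[mu]_(t in `[0, N]) (u t * (t `^ nu * bessel_series alpha (r * t))).

Lemma Rintegral_tail (f : R -> R) M N : 0 < M -> M <= N ->
  mu.-integrable `]0, N] (EFin \o f) ->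
  \int[mu]_(t in `[0, N]) f t - \int[mu]_(t in `[0, M]) f t =
  \int[mu]_(t in `[M, N]) f t.
Proof.
move=> M0 MN fi.
have fiM : mu.-integrable `]0, M] (EFin \o f).
  apply: integrableS fi => // t /=; rewrite !in_itv/= => /andP[-> tM].
  exact: le_trans MN.
rewrite -(Rintegral_itv_obnd_cbnd fi) -(Rintegral_itv_obnd_cbnd fiM).
rewrite Rintegral_itvB ?bnd_simp//; last exact: ltW.
apply: Rintegral_itv_obnd_cbnd; apply: integrableS fi => // t /=.
by rewrite !in_itv/= => /andP[Mt ->]; rewrite (lt_trans M0).
Qed.

Lemma real_transform_uniform :
  (forall e : R, 0 < e -> \forall t \near +oo, `|u t| <= e * t `^ (- nu - 1)) ->
  (forall e : R, 0 < e -> \forall a \near +oo, forall b, a <= b -> exists V J,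
    [/\ forall x y, a <= x -> x <= y -> y <= b -> `|u y - u x| <= V y - V x,
       is_stieltjes (fun t => t `^ (nu - alpha - 1 / 2)) V a b J &
       J <= e * a `^ (- alpha - 3 / 2)]) ->
  (forall e : R, 0 < e -> \forall K \near +oo, forall M N, K <= M -> M <= N ->
    `|\int[mu]_(t in `[M, N]) (u t * t `^ nu)| <= e) ->
  exists l : R -> R, forall e : R, 0 < e -> exists K : R, forall N r, 0 <= r ->
    K <= N -> `|real_transform_partial N r - l r| <= e.
Proof.
move=> ho hV hc.
apply: (@uniform_cauchy_limit _ real_transform_partial [set r | 0 <= r]) => e e0.
have [C C0 hC] := tail_bound nu halpha.
have C1 : 0 < C + 1 by rewrite ltr_wpDl.
(* [C] may be 0, hence the denominator C + 1. *)
pose e' := e / (C + 1); have e'0 : 0 < e' by rewrite divr_gt0.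
have [K0 [_ hK0]] := ho e' e'0.
have [K1 [_ hK1]] := hV e' e'0.
have [K2 [_ hK2]] := hc e' e'0.
(* Strictly above all three thresholds, and positive, so that the tails stay away from 0. *)
pose K := `|K0| + `|K1| + `|K2| + 1.
have n0 := normr_ge0 K0; have n1 := normr_ge0 K1; have n2 := normr_ge0 K2.
have l0 := ler_norm K0; have l1 := ler_norm K1; have l2 := ler_norm K2.
have K00 : 0 < K by rewrite /K; lra.
exists K => M N r /= r0 KM MN.
rewrite Rintegral_tail//; [|exact: lt_le_trans KM|exact: integrable_transform].
apply: (@le_trans _ _ (C * e')); last first.
  by rewrite /e' mulrCA ler_piMr ?(ltW e0)// ler_pdivrMr// mul1r lerDl.
apply: (hC u K e') => //; first exact: ltW.
- by move=> a b Ka; apply: locally_integrable_itv; exact: lt_le_trans Ka.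
- by move=> t Kt; apply: hK0; rewrite /K in Kt; lra.
- by move=> a b Ka ab; apply: (hK2 (`|K2| + 1)) => //; rewrite /K in Ka; lra.
- by move=> a b Ka ab; apply: hK1 => //; rewrite /K in Ka; lra.
Qed.

End real_transform.

(** * Passage between complex values and their components *)

Section complex_transform.
Context {R : realType}.
Implicit Types (f : R -> R[i]) (z : R[i]).

Local Notation mu := (@lebesgue_measure R).

Lemma normr_Re_le z : `|complex.Re z| <= cmod z.
Proof.
by case: z => x y /=; rewrite -sqrtr_sqr ler_wsqrtr// lerDl sqr_ge0.
Qed.

Lemma normr_Im_le z : `|complex.Im z| <= cmod z.
Proof.
by case: z => x y /=; rewrite -sqrtr_sqr ler_wsqrtr// lerDr sqr_ge0.
Qed.

Lemma cmod_le_ReIm z : cmod z <= `|complex.Re z| + `|complex.Im z|.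
Proof.
case: z => x y /=; rewrite -[leRHS]ger0_norm ?addr_ge0// -sqrtr_sqr.
rewrite ler_wsqrtr// sqrrD !real_normK ?num_real//.
by rewrite lerD2r lerDl mulrn_wge0// mulr_ge0.
Qed.

(** The kernel is real, so the transform acts on each component separately; r t >= 0 on the domain
    allows [bessel_jE]. *)
Lemma transform_partialE alpha nu f N r : - (1 / 2) <= alpha -> 0 <= r ->
  transform_partial alpha nu (- nu) f N r =
  ((real_transform_partial alpha nu (fun t => complex.Re (f t)) N r)
   +i* (real_transform_partial alpha nu (fun t => complex.Im (f t)) N r))%C.
Proof.
move=> halpha r0; rewrite /transform_partial addNr powRr0 mul1r /cintegral.
congr (_ +i* _)%C; apply: eq_Rintegral => t; rewrite inE/= in_itv/= => /andP[t0 _].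
- rewrite bessel_jE ?mulr_ge0//; case: (f t) => x y /=; ring.
- rewrite bessel_jE ?mulr_ge0//; case: (f t) => x y /=; ring.
Qed.

Lemma cintegral_weightE nu f N :
  cintegral `[0, N] (fun t => (t `^ nu)%:C%C * f t) =
  ((\int[mu]_(t in `[0, N]) (complex.Re (f t) * t `^ nu))
   +i* (\int[mu]_(t in `[0, N]) (complex.Im (f t) * t `^ nu)))%C.
Proof.
rewrite /cintegral; congr (_ +i* _)%C; apply: eq_Rintegral => t _.
- by case: (f t) => x y /=; ring.
- by case: (f t) => x y /=; ring.
Qed.

(** The norm of [R[i]^o] has values in [R[i]], so the real tolerance is embedded there and the
    inequality brought back by [ltcR]. *)
Lemma complex_cvg_near (F : R -> R[i]^o) (l : R[i]^o) : F N @[N --> +oo] --> l ->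
  forall e : R, 0 < e -> \forall N \near +oo, cmod (l - F N) < e.
Proof.
move=> Fl e e0; have ec0 : 0 < (e%:C%C : R[i]) by rewrite ltcR.
have := @pseudometric_normed_Zmodule.cvgr_dist_lt
  R[i] R[i]^o R (nbhs +oo%R) _ F l Fl _ ec0.
move=> h; near=> N.
have : `|l - F N| < e%:C%C by near: N; exact: h.
by rewrite [`|_|]/Num.norm/= ltcR.
Unshelve. all: by end_near. Qed.

Lemma complex_uniform_cvg (F : R -> R -> R[i]^o) (L : R -> R[i]^o) (E : set R) :
  (forall e : R, 0 < e -> exists K : R, forall N r, E r -> K <= N ->
     cmod (L r - F N r) < e) ->
  {uniform E, (F N : R -> R[i]^o) @[N --> +oo] --> L}.
Proof.
move=> FL P /uniform_nbhs[A [+ AP]].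
rewrite -entourage_ballE => -[/= e e0 eA].
(* In the order of [R[i]] a positive element has imaginary part 0. *)
have [a ea a0] : exists2 a : R, e = a%:C%C & 0 < a.
  case: e e0 {eA} => a b; rewrite ltcE/= => /andP[/eqP b0 a0].
  by exists a => //; rewrite b0.
have [K hK] := FL a a0; near=> N; apply: AP => r Er; apply: eA.
rewrite /= /ball/= ea [`|_|]/Num.norm/= ltcR; exact: hK.
Unshelve. all: by end_near. Qed.

(** [proj] stands for the real or the imaginary part. Compatibility with differences and |proj z| <=
    |z| are enough to carry the growth and variation hypotheses from f over to the component. *)
Lemma component_uniform alpha nu f (proj : R[i] -> R) : - (1 / 2) <= alpha ->
  (forall z w, proj (z - w) = proj z - proj w) ->
  (forall z, `|proj z| <= cmod z) ->
  clocally_bounded_variation f ->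
  locally_integrable `]0, +oo[ (proj \o f) ->
  mu.-integrable `]0, 1[ (EFin \o (fun t => proj (f t) * t `^ nu)) ->
  (fun M : R => cmod (f M)) =o_+oo (fun M : R => M `^ (- nu - 1)) ->
  (exists2 I : R -> R,
     (\forall M \near +oo,
        is_variation_integral (fun t => t `^ (nu - alpha - 1 / 2)) f M (I M)) &
     I =o_+oo (fun M : R => M `^ (- alpha - 3 / 2))) ->
  (forall e : R, 0 < e -> \forall K \near +oo, forall M N, K <= M -> M <= N ->
    `|\int[mu]_(t in `[M, N]) (proj (f t) * t `^ nu)| <= e) ->
  exists l : R -> R, forall e : R, 0 < e -> exists K : R, forall N r, 0 <= r ->
    K <= N -> `|real_transform_partial alpha nu (proj \o f) N r - l r| <= e.
Proof.
move=> halpha projB projN bv loc near0 /eqoP hf [I hI /eqoP hIo] hc.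
apply: real_transform_uniform => //.
- move=> e e0; near=> t; apply: (le_trans (projN _)).
  apply: (le_trans (ler_norm _)).
  have : `|cmod (f t)| <= e * `|t `^ (- nu - 1)| by near: t; exact: hf.
  by rewrite (ger0_norm (powR_ge0 _ _)).
- move=> e e0; near=> a => b ab.
  have a0 : 0 < a by near: a; apply: nbhs_pinfty_gt; exact: num_real.
  have Ia : is_variation_integral (fun t => t `^ (nu - alpha - 1 / 2)) f a (I a).
    by near: a.
  have [|V [J [fV sJ JI]]] := variation_integral_restrict bv a0 ab _ Ia.
    by move=> t _; exact: powR_ge0.
  exists V, J; split => //.
    move=> x y ax xy yb; rewrite /= -projB; apply: (le_trans (projN _)).
    exact: fV.
  apply: (le_trans JI); apply: (le_trans (ler_norm _)).
  have : `|I a| <= e * `|a `^ (- alpha - 3 / 2)| by near: a; exact: hIo.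
  by rewrite (ger0_norm (powR_ge0 _ _)).
Unshelve. all: by end_near. Qed.

(** Cauchy criterion: a tail is the difference of two partial integrals, each within e / 2 of the
    limit. *)
Lemma improper_integral_tail nu f (proj : R[i] -> R) :
  (forall z w, proj (z - w) = proj z - proj w) ->
  (forall z, `|proj z| <= cmod z) ->
  (forall N, proj (cintegral `[0, N] (fun t => (t `^ nu)%:C%C * f t)) =
     \int[mu]_(t in `[0, N]) (proj (f t) * t `^ nu)) ->
  locally_integrable `]0, +oo[ (proj \o f) ->
  mu.-integrable `]0, 1[ (EFin \o (fun t => proj (f t) * t `^ nu)) ->
  improper_integral_converges (fun t => (t `^ nu)%:C%C * f t) ->
  forall e : R, 0 < e -> \forall K \near +oo, forall M N, K <= M -> M <= N ->
    `|\int[mu]_(t in `[M, N]) (proj (f t) * t `^ nu)| <= e.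
Proof.
move=> projB projN projI loc near0 /cvg_ex[l hl] e e0.
have e20 : 0 < e / 2 by rewrite divr_gt0.
have [K [_ hK]] := complex_cvg_near hl e20.
near=> K' => M N KM MN.
have K'0 : 0 < K' by near: K'; apply: nbhs_pinfty_gt; exact: num_real.
have KK' : K < K' by near: K'; apply: nbhs_pinfty_gt; exact: num_real.
rewrite -(@Rintegral_tail _ (fun t => proj (f t) * t `^ nu)) //; last first.
- exact: (@integrable_weight _ nu (proj \o f)).
- exact: lt_le_trans KM.
rewrite -!projI -projB.
set FN := cintegral _ _; set FM := cintegral _ _.
have -> : FN - FM = (l - FM) - (l - FN) by ring.
rewrite projB; apply: (le_trans (ler_normB _ _)).
rewrite [leRHS]splitr; apply: lerD.
  by apply: (le_trans (projN _)); apply/ltW/hK; exact: lt_le_trans KM.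
apply: (le_trans (projN _)); apply/ltW/hK.
by rewrite (lt_le_trans KK')// (le_trans KM).
Unshelve. all: by end_near. Qed.

End complex_transform.

(** * The equivalence: evaluation at r = 0, and reassembly of the two components *)

Theorem theorem1p1 (R : realType) (alpha nu mu : R) (f : R -> R[i])
  (halpha : - (1 / 2) <= alpha)
  (hmu : mu = - nu)
  (hBV : clocally_bounded_variation f)
  (hint : clocally_integrable `]0, +oo[ f)
  (hL1 : cintegrable `]0, 1[ (fun t => (t `^ nu)%:C%C * f t))
  (hf : (fun M : R => cmod (f M)) =o_+oo (fun M : R => M `^ (- nu - 1)))
  (hdf : exists2 I : R -> R,
     (\forall M \near +oo,
        is_variation_integral (fun t => t `^ (nu - alpha - 1 / 2)) f M (I M)) &
     I =o_+oo (fun M : R => M `^ (- alpha - 3 / 2))) :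
  transform_converges_uniformly alpha nu mu f [set r | 0 <= r] <->
  improper_integral_converges (fun t => (t `^ nu)%:C%C * f t).
Proof.
rewrite hmu; have [intR intI] := hint; have [L1R L1I] := hL1.
have near0R : lebesgue_measure.-integrable `]0, 1[
    (EFin \o (fun t => complex.Re (f t) * t `^ nu)).
  apply: eq_integrable L1R => // t _ /=.
  by case: (f t) => x y /=; congr (_%:E); ring.
have near0I : lebesgue_measure.-integrable `]0, 1[
    (EFin \o (fun t => complex.Im (f t) * t `^ nu)).
  apply: eq_integrable L1I => // t _ /=.
  by case: (f t) => x y /=; congr (_%:E); ring.
have ReB (z w : R[i]) : complex.Re (z - w) = complex.Re z - complex.Re w.
  by case: z w => ? ? [].
have ImB (z w : R[i]) : complex.Im (z - w) = complex.Im z - complex.Im w.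
  by case: z w => ? ? [].
split.
- move=> [L FL]; apply/cvg_ex; exists (L 0).
  have : [set 0] `<=` [set r : R | 0 <= r] by move=> _ ->/=.
  move=> sub.
  (* Uniform convergence on the singleton {0} is convergence at that point. *)
  have := @uniform_subset_cvg _ _ L _ _ _ _ sub FL; rewrite uniform_set1.
  have -> : (fun N : R => cintegral `[0, N] (fun t => (t `^ nu)%:C%C * f t)) =
      (fun N => transform_partial alpha nu (- nu) f N 0).
    apply/funext => N; rewrite transform_partialE// cintegral_weightE.
    by congr (_ +i* _)%C; apply: eq_Rintegral => t _;
      rewrite mul0r bessel_series0// mulr1.
  by apply.
- move=> conv.
  have tailR := improper_integral_tail ReB (@normr_Re_le R)
    (fun N => congr1 (@complex.Re R) (cintegral_weightE nu f N)) intR near0R conv.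
  have tailI := improper_integral_tail ImB (@normr_Im_le R)
    (fun N => congr1 (@complex.Im R) (cintegral_weightE nu f N)) intI near0I conv.
  have [lR hR] := component_uniform halpha ReB (@normr_Re_le R) hBV
    intR near0R hf hdf tailR.
  have [lI hI] := component_uniform halpha ImB (@normr_Im_le R) hBV
    intI near0I hf hdf tailI.
  exists (fun r => (lR r +i* lI r)%C); apply: complex_uniform_cvg => e e0.
  (* A quarter for each component: the component bounds are not strict, and their sum e / 2 stays
     strictly below e. *)
  have e40 : 0 < e / 4 by rewrite divr_gt0.
  have [KR hKR] := hR _ e40; have [KI hKI] := hI _ e40.
  exists (Num.max KR KI) => N r r0; rewrite ge_max => /andP[NR NI].
  rewrite transform_partialE//.
  apply: (le_lt_trans (cmod_le_ReIm _)); rewrite /=.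
  apply: (@le_lt_trans _ _ (e / 4 + e / 4)); last by lra.
  by apply: lerD; rewrite distrC; [exact: hKR|exact: hKI].
Qed.
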